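(* Let $1<p<\infty$, let $\Omega$ be an open bounded domain of the Heisenberg group $\mathcal{H}^n$, and let $f:\Omega\times[0,\infty)\to(0,\infty)$ satisfy: (I) the function $r\mapsto f(x,r)$ is continuous on $[0,\infty)$ for a.e. $x\in\Omega$, and for every $r\ge 0$ the function $x\mapsto f(x,r)$ is in $L^\infty(\Omega)$; (II) the function $r\mapsto \frac{f(x,r)}{r^{p-1}}$ is strictly decreasing on $(0,\infty)$ for a.e. $x\in\Omega$; (III) there exists $C>0$ such that $f(x,r)\le C(r^{p-1}+1)$ for a.e. $x\in\Omega$ and for all $r\geq 0$. Then there exists at most one positive weak solution $u\in D^{1,p}_0(\Omega)$ of the problem $$-\Delta_p u=f(x,u)\ \text{in}\ \Omega,\qquad u\ge 0\ \text{and}\ u\not\equiv 0\ \text{in}\ \Omega,\qquad u=0\ \text{on}\ \partial\Omega.$$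
   Context: The Heisenberg group $\mathcal{H}^n$ is $\mathbb{R}^{2n+1}$ with points $(x,y,t)$, $x,y\in\mathbb{R}^n$, $t\in\mathbb{R}$, and group law $(x,y,t)\cdot(x',y',t')=(x+x',y+y',t+t'+2(\langle y,x'\rangle-\langle x,y'\rangle))$, where $\langle\cdot,\cdot\rangle$ is the standard inner product of $\mathbb{R}^n$. Its left-invariant vector fields include $\mathcal{X}_i=\frac{\partial}{\partial x_i}+2y_i\frac{\partial}{\partial t}$ and $\mathcal{Y}_i=\frac{\partial}{\partial y_i}-2x_i\frac{\partial}{\partial t}$, $i=1,\dots,n$. The symbol $\nabla$ denotes the horizontal gradient $\nabla_H=(\mathcal{X}_1,\dots,\mathcal{X}_n,\mathcal{Y}_1,\dots,\mathcal{Y}_n)$, and $\Delta_p$ denotes the $p$-sub-Laplacian $\Delta_{p}u=\nabla_H\cdot(|\nabla_H u|^{p-2}\nabla_H u)$. Integrals are with respect to Lebesgue measure $dx\,dy\,dt$. In the problem, a single letter $x$ denotes a point of $\Omega\subset\mathcal{H}^n$. The space $D^{1,p}_0(\Omega)$ is the closure of $C_0^\infty(\Omega)$ with respect to the norm $\|u\|_{D^{1,p}_0(\Omega)}=\left(\int_\Omega|\nabla_H u|^p\,dx\,dy\,dt\right)^{1/p}$. A weak solution in $D^{1,p}_0(\Omega)$ is understood in the standard sense: $\int_\Omega|\nabla u|^{p-2}\nabla u\cdot\nabla\varphi=\int_\Omega f(x,u)\varphi$ for all $\varphi\in C_0^\infty(\Omega)$, the boundary condition being expressed by $u\in D^{1,p}_0(\Omega)$.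 *)

(* Defs.v *)
From HB Require Import structures.
From mathcomp Require Import all_boot all_order all_algebra.
From mathcomp Require Import all_classical all_reals all_analysis.

Set Implicit Arguments.
Unset Strict Implicit.
Unset Printing Implicit Defensive.
Import Order.TTheory GRing.Theory Num.Theory.
Import numFieldNormedType.Exports.
Local Open Scope classical_set_scope.
Local Open Scope ring_scope.

(* The library has product measures but no Lebesgue measure on R^n. The
   sigma-algebra on 'rV[R]_n is the one generated by the coordinates (that is,
   the Borel one), and the measure is built by identifying R^n.+1 with
   R * R^n. *)
Section row_vector_measurable.
Context {R : realType} (n : nat).

Definition rV_coord (i : 'I_n) (v : 'rV[R]_n) : R := v ord0 i.

Let rV_set0 : g_sigma_preimage rV_coord set0.
Proof. exact: sigma_algebra0. Qed.

Let rV_setC A : g_sigma_preimage rV_coord A -> g_sigma_preimage rV_coord (~` A).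
Proof. exact: sigma_algebraC. Qed.

Let rV_bigcup (F : (set 'rV[R]_n)^nat) :
  (forall i, g_sigma_preimage rV_coord (F i)) ->
  g_sigma_preimage rV_coord (\bigcup_i (F i)).
Proof. exact: sigma_algebra_bigcup. Qed.

HB.instance Definition _ := @isMeasurable.Build default_measure_display
  'rV[R]_n (g_sigma_preimage rV_coord) rV_set0 rV_setC rV_bigcup.

Lemma measurable_rV_coord (i : 'I_n) : measurable_fun setT (rV_coord i).
Proof.
move=> _ Y mY; apply: sub_sigma_algebra => /=.
by rewrite -bigcup_seq/=; exists i; [rewrite /= mem_index_enum|exists Y].
Qed.

Lemma measurable_fun_rVP d (T : measurableType d) (f : T -> 'rV[R]_n) :
  measurable_fun setT f <->
  forall i, measurable_fun setT (fun x => rV_coord i (f x)).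
Proof.
split=> [mf i|mf]; first exact: measurableT_comp (measurable_rV_coord i) mf.
move=> _ A mA; rewrite setTI.
pose G := [set B : set 'rV[R]_n | measurable (f @^-1` B)].
suff sG : g_sigma_preimage rV_coord `<=` G by have := sG A mA; rewrite /G.
apply: smallest_sub.
  split => //=.
  - by rewrite /G/= preimage_set0.
  - by move=> B mB; rewrite /G/= setTD preimage_setC; exact: measurableC.
  - by move=> F mF; rewrite /G/= preimage_bigcup; apply: bigcup_measurable => k _; exact: mF.
rewrite -bigcup_seq; apply: bigcup_sub => i _ _ [B mB <-].
by rewrite /G/= setTI -comp_preimage -[X in measurable X]setTI; exact: (mf i).
Qed.

End row_vector_measurable.

Section row_vector_lebesgue.
Context {R : realType}.

Definition rV_cons n (z : measurableTypeR R * 'rV[R]_n) : 'rV[R]_n.+1 :=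
  row_mx (const_mx z.1 : 'rV[R]_1) z.2.

Lemma rV_cons0 n (z : measurableTypeR R * 'rV[R]_n) :
  rV_cons z ord0 ord0 = z.1.
Proof. by rewrite mxE; case: splitP => [j _|//]; rewrite mxE. Qed.

Lemma rV_consS n (z : measurableTypeR R * 'rV[R]_n) (i : 'I_n) :
  rV_cons z ord0 (lift ord0 i) = z.2 ord0 i.
Proof.
rewrite mxE; case: splitP => [j|j /= /eqP]; first by rewrite (ord1 j).
by rewrite /bump/= eqn_add2l => /eqP ij; congr (z.2 ord0 _); apply/val_inj.
Qed.

Lemma measurable_rV_cons n : measurable_fun setT (@rV_cons n).
Proof.
apply/measurable_fun_rVP => i; rewrite /rV_coord.
have [j ->|->] := unliftP ord0 i.
  under eq_fun do rewrite rV_consS.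
  exact: measurableT_comp (measurable_rV_coord j) measurable_snd.
by under eq_fun do rewrite rV_cons0; exact: measurable_fst.
Qed.

Lemma measurable_rV_behead n :
  measurable_fun setT (fun v : 'rV[R]_n.+1 => \row_i v ord0 (lift ord0 i)).
Proof.
apply/measurable_fun_rVP => i; rewrite /rV_coord.
rewrite (_ : (fun _ => _) = rV_coord (lift ord0 i)) ?funeqE => [|v]; last first.
  by rewrite mxE.
exact: measurable_rV_coord.
Qed.

Section lebesgue_rV_step.
Local Open Scope ereal_scope.
Variables (n : nat) (m : {sigma_finite_measure set 'rV[R]_n -> \bar R}).

Definition lebesgue_rV_step : set 'rV[R]_n.+1 -> \bar R :=
  pushforward (lebesgue_measure \x m) (@rV_cons n).

Let step0 : lebesgue_rV_step set0 = 0.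
Proof. by rewrite /lebesgue_rV_step /pushforward preimage_set0 measure0. Qed.

Let step_ge0 A : 0 <= lebesgue_rV_step A.
Proof. exact: (measure_ge0 (lebesgue_measure \x m)). Qed.

Let step_sigma_additive : semi_sigma_additive lebesgue_rV_step.
Proof.
move=> F mF tF mUF; rewrite /lebesgue_rV_step /pushforward preimage_bigcup.
apply: measure_semi_sigma_additive.
- by move=> k; rewrite -[X in measurable X]setTI; exact: measurable_rV_cons.
- apply/trivIsetP => /= i j _ _ ij; rewrite -preimage_setI.
  by move/trivIsetP : tF => /(_ _ _ _ _ ij) ->//; rewrite preimage_set0.
- rewrite -preimage_bigcup -[X in measurable X]setTI.
  exact: measurable_rV_cons.
Qed.

HB.instance Definition _ := isMeasure.Build _ _ _ lebesgue_rV_step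
  step0 step_ge0 step_sigma_additive.

Let step_sigma_finite : sigma_finite setT lebesgue_rV_step.
Proof.
have [F [TF Foo]] : exists F : (set (measurableTypeR R * 'rV[R]_n))^nat,
    setT = \bigcup_k F k /\
    forall k, measurable (F k) /\ (lebesgue_measure \x m) (F k) < +oo.
  have /sigma_finiteP[A [TA ndA Aoo]] := sigma_finiteT (@lebesgue_measure R).
  have /sigma_finiteP[B [TB ndB Boo]] := sigma_finiteT m.
  exists (fun k => A k `*` B k); split.
    rewrite -setXTT TA TB predeqE => -[x y]; split.
      move=> [/= [i _ Aix] [k _ Bky]]; exists (maxn i k) => //; split.
      - by move: x Aix; exact/subsetPset/ndA/leq_maxl.
      - by move: y Bky; exact/subsetPset/ndB/leq_maxr.
    by move=> [i _ []/= ? ?]; split; exists i.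
  move=> k; have [? ?] := Aoo k; have [? ?] := Boo k.
  split; first exact: measurableX.
  by rewrite product_measure1E// lte_mul_pinfty// ge0_fin_numE.
pose g (v : 'rV[R]_n.+1) : measurableTypeR R * 'rV[R]_n :=
  (v ord0 ord0, \row_i v ord0 (lift ord0 i)).
have mg : measurable_fun setT g.
  apply/measurable_fun_pairP; split; first exact: (measurable_rV_coord ord0).
  exact: measurable_rV_behead.
have gK z : g (rV_cons z) = z.
  case: z => a v; rewrite /g rV_cons0; congr pair.
  by apply/rowP => i; rewrite mxE rV_consS.
exists (fun k => g @^-1` F k).
  by rewrite -preimage_bigcup -TF preimage_setT.
move=> k; have [mFk Fkoo] := Foo k; split.
  by rewrite -[X in measurable X]setTI; exact: mg.
rewrite /lebesgue_rV_step /pushforward -comp_preimage.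
by rewrite (_ : g \o _ = id) ?preimage_id//; apply/funext.
Qed.

HB.instance Definition _ := Measure_isSigmaFinite.Build _ _ _ lebesgue_rV_step
  step_sigma_finite.

End lebesgue_rV_step.

Fixpoint lebesgue_rV n : {sigma_finite_measure set 'rV[R]_n -> \bar R} :=
  match n with
  | 0%N => dirac (0 : 'rV[R]_0)
  | n'.+1 => lebesgue_rV_step (lebesgue_rV n')
  end.

Lemma lebesgue_rV_box n (a b : 'I_n -> R) : (forall i, a i <= b i) ->
  lebesgue_rV n [set v | forall i, a i < v ord0 i <= b i] =
  (\prod_(i < n) (b i - a i))%:E.
Proof.
elim: n a b => [|n IH] a b ab.
  by rewrite big_ord0 /= diracE mem_set//= => -[].
rewrite [LHS]/= /lebesgue_rV_step /pushforward.
pose a' i := a (lift ord0 i); pose b' i := b (lift ord0 i).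
pose B := [set v : 'rV[R]_n | forall i, a' i < v ord0 i <= b' i].
have mB : measurable B.
  rewrite (_ : B = \bigcap_(i in [set: 'I_n])
      (rV_coord i @^-1` [set` `]a' i, b' i]])).
    apply: fin_bigcap_measurable => // i _.
    by rewrite -[X in measurable X]setTI; exact: measurable_rV_coord.
  apply/seteqP; split=> [v Bv i _|v Bv i]; first by rewrite /= in_itv/= Bv.
  by have := Bv i I; rewrite /= in_itv.
rewrite (_ : _ @^-1` _ =
    (`]a ord0, b ord0] : set (measurableTypeR R)) `*` B); last first.
  apply/seteqP; split=> [z /= zab|z [/= z1 z2] i].
    split; first by have := zab ord0; rewrite rV_cons0 /= in_itv.
    by move=> i; have := zab (lift ord0 i); rewrite rV_consS.
  have [j ->|->] := unliftP ord0 i; first by rewrite rV_consS; exact: z2.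
  by rewrite rV_cons0; move: z1; rewrite in_itv.
rewrite product_measure1E//= IH => [|i]; last exact: ab.
rewrite big_ord_recl EFinM; congr (_ * _)%E.
rewrite lebesgue_measure_itv/= lte_fin.
by have := ab ord0; case: ltgtP => // -> _; rewrite subrr.
Qed.

End row_vector_lebesgue.

(* The Heisenberg group, with (x, y, t) stored as one row vector of length
   n + n + 1; the library norm on it is the sup norm. *)
Notation heisenberg R n := 'rV[R]_(n + n + 1).

Section heisenberg.
Context {R : realType} {n : nat}.
Local Notation H := (heisenberg R n).
Implicit Types (p : R) (Omega : set H) (u phi : H -> R).

Definition x_idx (i : 'I_n) : 'I_(n + n + 1) := lshift 1 (lshift n i).
Definition y_idx (i : 'I_n) : 'I_(n + n + 1) := lshift 1 (rshift n i).
Definition t_idx : 'I_(n + n + 1) := rshift (n + n) ord0.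

Definition heisenberg_measure : {sigma_finite_measure set H -> \bar R} :=
  lebesgue_rV (n + n + 1).
Local Notation mu := heisenberg_measure.

Definition partial (j : 'I_(n + n + 1)) (phi : H -> R) (z : H) : R :=
  'D_(delta_mx ord0 j) phi z.

Definition vfX (i : 'I_n) phi (z : H) : R :=
  partial (x_idx i) phi z + 2 * z ord0 (y_idx i) * partial t_idx phi z.

Definition vfY (i : 'I_n) phi (z : H) : R :=
  partial (y_idx i) phi z - 2 * z ord0 (x_idx i) * partial t_idx phi z.

Definition hgrad phi (z : H) : 'rV[R]_(n + n) :=
  row_mx (\row_i vfX i phi z) (\row_i vfY i phi z).

(* The library norm on row vectors is the sup norm, whence these. *)
Definition dotv m (v w : 'rV[R]_m) : R := \sum_i v ord0 i * w ord0 i.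
Definition enorm m (v : 'rV[R]_m) : R := Num.sqrt (dotv v v).

Definition smooth phi : Prop :=
  forall s : seq 'I_(n + n + 1),
    continuous (foldr partial phi s) /\
    forall j z, derivable (foldr partial phi s) z (delta_mx ord0 j).

Definition test_function Omega phi : Prop :=
  [/\ smooth phi, compact (closure [set z | phi z != 0])
    & closure [set z | phi z != 0] `<=` Omega].

(* measurable_fun refers to Borel sets: being Lebesgue measurable is being
   almost everywhere equal to a Borel measurable function. *)
Definition lebesgue_measurable Omega (g : H -> R) : Prop :=
  exists2 h : H -> R, measurable_fun Omega h
                    & {ae mu, forall z, Omega z -> g z = h z}.

Definition Lp_norm (q : \bar R) Omega (g : H -> R) : \bar R :=
  ('N[mu]_q[(EFin \o g) \_ Omega])%E.

Lemma Lp_normE p Omega (g : H -> R) : p != 0 ->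
  Lp_norm p%:E Omega g =
  ((\int[mu]_(z in Omega) (`|g z| `^ p)%:E) `^ p^-1)%E.
Proof.
move=> p0; rewrite /Lp_norm unlock; congr poweR.
rewrite [RHS]integral_mkcond; apply: eq_integral => z _ /=.
by rewrite !patchE; case: ifP => //= _; rewrite normr0 powR0.
Qed.

Definition Lp (q : \bar R) Omega (g : H -> R) : Prop :=
  lebesgue_measurable Omega g /\ (Lp_norm q Omega g < +oo)%E.

(* u belongs to D^{1,p}_0(Omega) and has horizontal gradient G. The completion
   of the test functions for the norm ||grad phi||_p is realized by functions:
   its elements are given by sequences of test functions that are Cauchy for
   this norm, that is, whose gradients converge in L^p to some G, and such an
   element is identified with the almost everywhere limit u of the sequence.
   When Omega is bounded, by the Poincare inequality any such Cauchy sequence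
   converges in L^p, so that some subsequence has an almost everywhere limit,
   and u and G determine each other up to null sets. *)
Definition D01p_gradient p Omega u (G : H -> 'rV[R]_(n + n)) : Prop :=
  (forall i, Lp p%:E Omega (fun z => G z ord0 i)) /\
  exists phi : nat -> H -> R,
    [/\ forall k, test_function Omega (phi k),
        (fun k => Lp_norm p%:E Omega (fun z => enorm (hgrad (phi k) z - G z)))
          @ \oo --> 0%E
      & {ae mu, forall z, Omega z -> (fun k => phi k z) @ \oo --> u z}].

Definition D01p p Omega : set (H -> R) :=
  [set u | exists G, D01p_gradient p Omega u G].

(* -Delta_p u = f(z, u) in Omega, u = 0 on the boundary. Where G z = 0 the
   value of the power is irrelevant, also for p < 2. *)
Definition weak_solution p Omega (f : H -> R -> R) u : Prop :=
  D01p p Omega u /\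
  exists2 G, D01p_gradient p Omega u G &
    forall phi, test_function Omega phi ->
      (\int[mu]_(z in Omega)
         (enorm (G z) `^ (p - 2) * dotv (G z) (hgrad phi z))%:E =
       \int[mu]_(z in Omega) (f z (u z) * phi z)%:E)%E.

Definition positive_weak_solution p Omega (f : H -> R -> R) u : Prop :=
  [/\ weak_solution p Omega f u,
      {ae mu, forall z, Omega z -> 0 <= u z},
      ~ {ae mu, forall z, Omega z -> u z = 0}
    & {ae mu, forall z, Omega z -> 0 < u z}].

End heisenberg.

(* Main.v *)
(* Let u, v be positive solutions with right-hand sides F = f(., u) and
   F' = f(., v). Picone's inequality amounts to testing the equation of u with
   v^p / u^(p-1) and yields
     \int F v^p / u^(p-1) <= \int |grad v|^p = \int F' v < +oo,
   and the same with u and v exchanged. Adding the two inequalities,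
     \int (v^p - u^p) (F / u^(p-1) - F' / v^(p-1)) <= 0,
   while the integrand is positive wherever u <> v, since f(z, r) / r^(p-1) is
   strictly decreasing.
   Nothing is known about the boundedness of u and v, or about their positivity
   away from 0, so all test functions are smooth functions of the test functions
   that approximate u and v, with coefficients that remain bounded in the limit:
   Picone's inequality is first proved for a test function phi in place of v, and
   phi tends to v by Fatou's lemma. *)

Require Import Defs.
From mathcomp Require Import all_boot all_order all_algebra.
From mathcomp Require Import all_classical all_reals all_analysis.
From mathcomp Require Import measurable_realfun ring lra.

Set Implicit Arguments.
Unset Strict Implicit.
Import Order.TTheory GRing.Theory Num.Theory.
Import numFieldNormedType.Exports.
Local Open Scope classical_set_scope.
Local Open Scope ring_scope.

(** * Smooth functions and test functions *)

(** The approximations [psi k] of [u] have no controlled sign or size, and the pointwise form of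
    Picone's inequality needs a nonnegative argument. So [u^(1-p)] is replaced by a profile of
    [psi k] that is smooth, positive and bounded on the whole line, compact support is left to a
    fixed test function [phi], and k tends to infinity before any inequality is used. The majorant
    of the right-hand side needs no prior integrability of f(., u): the equation tested with that
    majorant says that it is integrable. Regularizing spoils the cancellation in Picone's inequality
    by at most (p - 1) c^p |grad u|^p, where c is the regularization parameter; this error
    disappears when c tends to 0 together with phi -> v. The equality of \int |grad u|^p and \int F
    u is a separate obstacle, since [u] is no test function and truncations such as min(u, phi) are
    not smooth. A rational substitute for them has derivatives bounded uniformly in c and stays
    below 2 u, while F u is integrable by Picone's inequality with both solutions equal. *)

Section smooth_functions.
Context {R : realType} {n : nat}.
Local Notation H := (heisenberg R n).
Implicit Types (phi psi Q : H -> R) (j : 'I_(n + n + 1)) (z : H).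

(** Restriction to the line [t *: v + z] reduces this to the chain rule in one variable; [Q] is only
    given a directional derivative, not differentiability. *)
Lemma is_derive_comp1 (g : R -> R) (Q : H -> R) (z v : H) (dg : R) :
  derivable Q z v -> is_derive (Q z) 1 g dg ->
  is_derive z v (g \o Q) (dg * 'D_v Q z).
Proof.
move=> dQ [dgz gE].
have E (h : H -> R) : 'D_v h z = (fun t : R => h (t *: v + z))^`()%classic 0.
  rewrite derive1E /derive; set g1 := fun t => t^-1 *: _.
  set g2 := fun t => t^-1 *: _; suff -> : g1 = g2 by [].
  apply/funext => t; rewrite /g1 /g2 /=.
  by rewrite addr0 scale0r add0r [_%:A]mulr1.
have Q0 : Q (0 *: v + z) = Q z by rewrite scale0r add0r.
have dQ1 : derivable (fun t : R => Q (t *: v + z)) 0 1 by exact: (derivable1P _ _ _).1.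
have dg1 : derivable g (Q (0 *: v + z)) 1 by rewrite Q0; exact: dgz.
apply: DeriveDef.
  apply/derivable1P/derivable1_diffP.
  apply: (@differentiable_comp _ _ _ _ (fun t : R => Q (t *: v + z)) g).
    by move/derivable1_diffP : dQ1.
  by move/derivable1_diffP : dg1.
rewrite !E; have := derive1_comp dQ1 dg1.
by rewrite /comp => ->; rewrite Q0 derive1E gE.
Qed.

(** [smooth] speaks of all words of derivatives at once; bounding their length allows closure under
    products and powers to be proved by induction. *)
Definition smooth_upto (m : nat) phi := forall s : seq 'I_(n + n + 1),
  (size s <= m)%N -> continuous (foldr partial phi s) /\
    forall j z, derivable (foldr partial phi s) z (delta_mx ord0 j).

Lemma smoothP phi : smooth phi <-> forall m, smooth_upto m phi.
Proof.
by split=> [h m s _|h s]; [exact: h|exact: (h (size s))].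
Qed.

(** The word is split at its last letter, which [foldr] applies first: what remains is a word of
    derivatives of [partial j phi], for which a product or chain rule is available. *)
Lemma smooth_uptoS m phi : smooth_upto m.+1 phi <->
  smooth_upto 0 phi /\ forall j, smooth_upto m (partial j phi).
Proof.
split=> [h|[h0 hS] s].
  split=> [s s0|j s sm]; first by apply: h; exact: leq_trans s0 _.
  by have := h (rcons s j); rewrite size_rcons foldr_rcons; apply.
case/lastP: s => [_|s j]; first exact: (h0 [::]).
by rewrite size_rcons foldr_rcons; exact: hS.
Qed.

Lemma smooth_upto0 phi : smooth_upto 0 phi <->
  continuous phi /\ forall j z, derivable phi z (delta_mx ord0 j).
Proof.
split=> [h|h s]; first exact: (h [::]).
by rewrite leqn0 => /nilP ->.
Qed.

Lemma smooth_uptoW m phi : smooth_upto m.+1 phi -> smooth_upto m phi.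
Proof. by move=> h s sm; apply: h; exact: leqW. Qed.

Lemma smooth_upto_is_derive m phi j z : smooth_upto m phi ->
  is_derive z (delta_mx ord0 j) phi (partial j phi z).
Proof. by move=> /(_ [::] (leq0n _))[_ /(_ j z)]; exact: derivableP. Qed.

Lemma is_derive_partial phi j z (d : R) :
  is_derive z (delta_mx ord0 j) phi d -> partial j phi z = d.
Proof. by move=> [_]. Qed.

Lemma smooth_is_derive phi j z : smooth phi ->
  is_derive z (delta_mx ord0 j) phi (partial j phi z).
Proof. by move=> /smoothP/(_ 0%N); exact: smooth_upto_is_derive. Qed.

Lemma smooth_continuous phi : smooth phi -> continuous phi.
Proof. by move=> /(_ [::])[]. Qed.

Lemma smooth_partial phi j : smooth phi -> smooth (partial j phi).
Proof. by move=> h s; have := h (rcons s j); rewrite foldr_rcons. Qed.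

Lemma smooth_cst (c : R) : smooth ((fun=> c) : H -> R).
Proof.
apply/smoothP => m; elim: m c => [|m IH] c.
  by apply/smooth_upto0; split=> [|j z]; [exact: cst_continuous|exact: derivable_cst].
apply/smooth_uptoS; split; first by move=> s s0; apply: IH; exact: leq_trans s0 _.
move=> j; rewrite (_ : partial j _ = fun=> 0); first exact: IH.
by apply/funext => z; apply: is_derive_partial; exact: is_derive_cst.
Qed.

Lemma smooth_uptoD m phi psi : smooth_upto m phi -> smooth_upto m psi ->
  smooth_upto m (fun z => phi z + psi z).
Proof.
elim: m phi psi => [|m IH] phi psi hphi hpsi.
  have [cphi dphi] := (smooth_upto0 _).1 hphi.
  have [cpsi dpsi] := (smooth_upto0 _).1 hpsi.
  apply/smooth_upto0; split=> [z|j z]; first exact: cvgD (cphi z) (cpsi z).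
  exact: derivableD.
apply/smooth_uptoS; split.
  have h : smooth_upto m (fun z => phi z + psi z) by apply: IH; exact: smooth_uptoW.
  by move=> s s0; apply: h; exact: leq_trans s0 _.
move=> j; rewrite (_ : partial j _ = fun z => partial j phi z + partial j psi z).
  by apply: IH; [have [_] := (smooth_uptoS _ _).1 hphi|
    have [_] := (smooth_uptoS _ _).1 hpsi]; apply.
apply/funext => z; apply: is_derive_partial.
have := smooth_upto_is_derive j z hphi; have := smooth_upto_is_derive j z hpsi.
by move=> ? ?; exact: is_deriveD.
Qed.

Lemma smooth_uptoM m phi psi : smooth_upto m phi -> smooth_upto m psi ->
  smooth_upto m (fun z => phi z * psi z).
Proof.
elim: m phi psi => [|m IH] phi psi hphi hpsi.
  have [cphi dphi] := (smooth_upto0 _).1 hphi.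
  have [cpsi dpsi] := (smooth_upto0 _).1 hpsi.
  apply/smooth_upto0; split=> [z|j z]; first exact: cvgM (cphi z) (cpsi z).
  exact: derivableM.
apply/smooth_uptoS; split.
  have h : smooth_upto m (fun z => phi z * psi z) by apply: IH; exact: smooth_uptoW.
  by move=> s s0; apply: h; exact: leq_trans s0 _.
move=> j; rewrite (_ : partial j _ =
    fun z => phi z * partial j psi z + psi z * partial j phi z).
  have [_ dphi] := (smooth_uptoS _ _).1 hphi.
  have [_ dpsi] := (smooth_uptoS _ _).1 hpsi.
  apply: smooth_uptoD; apply: IH.
  - exact: smooth_uptoW hphi.
  - exact: dpsi.
  - exact: smooth_uptoW hpsi.
  - exact: dphi.
apply/funext => z; apply: is_derive_partial.
have := smooth_upto_is_derive j z hphi; have := smooth_upto_is_derive j z hpsi.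
by move=> ? ?; exact: is_deriveM.
Qed.

Lemma smoothD phi psi : smooth phi -> smooth psi ->
  smooth (fun z => phi z + psi z).
Proof.
by move=> /smoothP h1 /smoothP h2; apply/smoothP => m; exact: smooth_uptoD.
Qed.

Lemma smoothM phi psi : smooth phi -> smooth psi ->
  smooth (fun z => phi z * psi z).
Proof.
by move=> /smoothP h1 /smoothP h2; apply/smoothP => m; exact: smooth_uptoM.
Qed.

(** Differentiation lowers the exponent, so the induction on the order runs over all exponents [r]
    simultaneously. *)
Lemma smooth_powR Q (r : R) : (forall z, 0 < Q z) -> smooth Q ->
  smooth (fun z => Q z `^ r).
Proof.
move=> Q0 /smoothP sQ; apply/smoothP => m; elim: m r => [|m IH] r.
  have [cQ dQ] := (smooth_upto0 _).1 (sQ 0%N).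
  apply/smooth_upto0; split=> [z|j z].
    have [/derivable1_diffP/differentiable_continuous gz _] :=
      @is_derive1_powR R r (Q z) (Q0 z).
    have : {for z, continuous (@powR R ^~ r \o Q)}.
      by apply: continuous_comp; [exact: cQ|exact: gz].
    by move=> h; apply: h.
  by have [] := is_derive_comp1 (dQ j z) (is_derive1_powR r (Q0 z)).
apply/smooth_uptoS; split.
  by move=> s s0; apply: (IH r); exact: leq_trans s0 _.
move=> j; rewrite (_ : partial j _ = fun z => r * Q z `^ (r - 1) * partial j Q z).
  apply: smooth_uptoM; last by have [_] := (smooth_uptoS _ _).1 (sQ m.+1); apply.
  by apply: smooth_uptoM => //; have /smoothP := smooth_cst r; exact.
apply/funext => z; apply: is_derive_partial.
have [_ dQ] := (smooth_upto0 _).1 (sQ 0%N).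
exact: (is_derive_comp1 (dQ j z) (is_derive1_powR r (Q0 z))).
Qed.

Lemma partial_cst j (c : R) z : partial j ((fun=> c) : H -> R) z = 0.
Proof. by apply: is_derive_partial; exact: is_derive_cst. Qed.

Lemma partialD phi psi j z : smooth phi -> smooth psi ->
  partial j (fun x => phi x + psi x) z = partial j phi z + partial j psi z.
Proof.
move=> s1 s2; apply: is_derive_partial.
have := smooth_is_derive j z s1; have := smooth_is_derive j z s2.
by move=> ? ?; exact: is_deriveD.
Qed.

Lemma partialM phi psi j z : smooth phi -> smooth psi ->
  partial j (fun x => phi x * psi x) z =
  phi z * partial j psi z + psi z * partial j phi z.
Proof.
move=> s1 s2; apply: is_derive_partial.
have := smooth_is_derive j z s1; have := smooth_is_derive j z s2.
by move=> ? ?; exact: is_deriveM.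
Qed.

Lemma partial_powR Q (r : R) j z : (forall z, 0 < Q z) -> smooth Q ->
  partial j (fun x => Q x `^ r) z = r * Q z `^ (r - 1) * partial j Q z.
Proof.
move=> Q0 sQ; apply: is_derive_partial.
have [dQ _] := smooth_is_derive j z sQ.
exact: (is_derive_comp1 dQ (is_derive1_powR r (Q0 z))).
Qed.

(** The horizontal fields have no zeroth-order term, so a chain rule for the partial derivatives at
    [z] carries over to [hgrad] with the same coefficients. *)
Lemma hgrad_lin phi psi w (a b : R) z :
  (forall j, partial j w z = a * partial j psi z + b * partial j phi z) ->
  hgrad w z = a *: hgrad psi z + b *: hgrad phi z.
Proof.
move=> E; rewrite /hgrad !scale_row_mx add_row_mx; congr row_mx; apply/rowP => i;
  rewrite !mxE ?/vfX ?/vfY !E !mulrDr ?opprD [in LHS]addrACA;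
  by congr (_ + _); rewrite ?[in RHS]mulrN mulrCA.
Qed.

(** All composite test functions get their compact support in this way, by vanishing wherever [phi]
    does. *)
Lemma test_function_sub Omega phi w : test_function Omega phi -> smooth w ->
  (forall z, phi z = 0 -> w z = 0) -> test_function Omega w.
Proof.
move=> [_ cK KO] sw wphi.
have sub : closure [set z | w z != 0] `<=` closure [set z | phi z != 0].
  apply: closure_subset => z /=; apply: contra_neq; exact: wphi.
split=> //; last exact: subset_trans sub KO.
by apply: subclosed_compact sub => //; exact: closed_closure.
Qed.

Lemma test_function_bounded Omega phi : test_function Omega phi ->
  exists2 M : R, 0 < M & forall z, `|phi z| <= M.
Proof.
move=> [/smooth_continuous cphi cK _].
have : compact (phi @` closure [set z | phi z != 0]).
  by apply: continuous_compact => //; apply: continuous_subspaceT.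
move=> /compact_bounded[M [_ bM]].
exists (`|M| + 1) => [|z]; first by rewrite ltr_wpDl.
have [->|nz] := eqVneq (phi z) 0; first by rewrite normr0 addr_ge0.
apply: (bM (`|M| + 1)); first by rewrite (le_lt_trans (ler_norm M))// ltrDl.
by exists z => //; apply: subset_closure.
Qed.

End smooth_functions.

(** * Borel sets, null sets and superposition operators *)

Section borel_row_vectors.
Context {R : realType} {N : nat}.

(** Sup-norm balls are boxes, hence measurable for the sigma-algebra of the coordinates, and an open
    set is the union of the countably many rational boxes that it contains. *)
Lemma open_measurable_rV (U : set 'rV[R]_N) : open U -> measurable U.
Proof.
move=> oU.
pose B (k : 'rV[rat]_N * nat) : set 'rV[R]_N :=
  [set v | forall i, `|ratr (k.1 ord0 i) - v ord0 i| < k.2.+1%:R^-1].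
have mB k : measurable (B k).
  rewrite (_ : B k = \bigcap_(i in [set: 'I_N])
      (rV_coord i @^-1` ball (ratr (k.1 ord0 i) : R) k.2.+1%:R^-1)).
    apply: fin_bigcap_measurable => // i _.
    rewrite -[X in measurable X]setTI; apply: measurable_rV_coord => //.
    exact: open_measurable (ball_open _ _).
  by apply/seteqP; split=> [v Bv i _|v Bv i]; [exact: Bv|exact: (Bv i I)].
rewrite (_ : U = \bigcup_(k : {k | `[< B k `<=` U >]}) B (val k)).
  by apply: countable_bigcupT_measurable => [|k]; [exact: countableP|exact: mB].
apply/seteqP; split=> [v Uv|v [[k /= kU] _]]; last by move/asboolP : kU; apply.
have /nbhs_ballP[e /= e0 eU] : nbhs v U by exact: open_nbhs_nbhs.
(* The factor 2 is there because [v] and any other point of the box are both within [m.+1%:R^-1] of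
   its rational centre. *)
have [m me] : exists m : nat, 2 * m.+1%:R^-1 < e.
  have [m _ /(_ m (leqnn m)) /=] :=
    near_infty_natSinv_lt (PosNum (divr_gt0 e0 (ltr0Sn R 1))).
  by move=> h; exists m; rewrite -ltr_pdivlMl// mulrC.
have /choice[q hq] : forall i : 'I_N, exists q : rat,
    `|ratr q - v ord0 i| < m.+1%:R^-1.
  move=> i.
  have : v ord0 i - m.+1%:R^-1 < v ord0 i + m.+1%:R^-1.
    by rewrite ltrD2l gtrN// invr_gt0.
  move=> /rat_in_itvoo[q]; rewrite in_itv/= => /andP[q1 q2].
  by exists q; rewrite ltr_distl q1.
have kU : B (\row_i q i, m) `<=` U.
  move=> w Bw; apply: eU; split=> // i j; rewrite (ord1 i) /ball /=.
  have /= := Bw j; rewrite mxE => qw; have qv := hq j.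
  rewrite (le_lt_trans (ler_distD (ratr (q j)) _ _))//.
  by rewrite (le_lt_trans _ me)// mulr_natl mulr2n lerD// ?ltW// distrC.
exists (exist (fun k => `[< B k `<=` U >]) (\row_i q i, m) (asboolT kU)) => // i /=.
by rewrite mxE; exact: hq.
Qed.

Lemma continuous_measurable_rV (f : 'rV[R]_N -> R) :
  continuous f -> measurable_fun setT f.
Proof.
move=> cf; apply: (measurability _ (RGenOpens.measurableE R)).
move=> _ [_ [a [b ->]] <-]; rewrite setTI; apply: open_measurable_rV.
by apply: open_comp => [x _|]; [exact: cf|exact: interval_open].
Qed.

End borel_row_vectors.

Section null_sets.
Context d (T : measurableType d) (R : realType).
Variable mu : {measure set T -> \bar R}.
Import HBNNSimple.

(** The integrands of the weak formulation are only almost everywhere equal to Borel functions. The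
    proof therefore works with the supremum over simple functions that defines the integral: cutting
    [h] off on [N] keeps its integral. *)
Lemma ge0_integral_setD_null (D N : set T) (f : T -> \bar R) :
  measurable N -> mu N = 0%E -> (forall x, D x -> 0 <= f x)%E ->
  (\int[mu]_(x in D) f x = \int[mu]_(x in D `\` N) f x)%E.
Proof.
move=> mN N0 f0; rewrite !ge0_integralE//; last by move=> x [/f0].
apply/eqP; rewrite eq_le; apply/andP; split; last first.
  apply: ereal_sup_le => _ [h hf <-]; exists h => // x.
  apply: le_trans (hf x) _; rewrite !patchE.
  case: ifPn => [|_]; first by rewrite in_setD => /andP[->].
  by case: ifPn => //; rewrite inE; exact: f0.
apply: ereal_sup_le => _ [h hf <-].
have mNC := measurableC mN.
exists (proj_nnsfun h mNC) => [x|].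
  rewrite -mrestrict; have := hf x; rewrite !patchE in_setC in_setD.
  by case: (x \in N); case: (x \in D).
rewrite -mrestrict -integral_nnsfun// -setTD -ge0_negligible_integral//.
- by rewrite integral_nnsfun// patch_setT.
- exact/measurable_EFinP.
- by move=> x _; rewrite lee_fin.
Qed.

Lemma integral_setD_null (D N : set T) (f : T -> \bar R) :
  measurable N -> mu N = 0%E ->
  (\int[mu]_(x in D) f x = \int[mu]_(x in D `\` N) f x)%E.
Proof.
move=> mN N0; rewrite integralE [RHS]integralE.
by congr (_ - _)%E; exact: ge0_integral_setD_null.
Qed.

End null_sets.

(** Caratheodory's argument: [u] is rounded down to the grid of step [m.+1%:R^-1], and on each of
    the countably many pieces the second argument of [g] is a fixed rational. Rounding keeps it in
    [[0, +oo[], where [g z] is continuous. *)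
Lemma measurable_superposition d (T : measurableType d) (R : realType)
    (D : set T) (g : T -> R -> R) (u : T -> R) :
  measurable D -> measurable_fun D u -> (forall z, D z -> 0 <= u z) ->
  (forall z, D z -> {within `[0, +oo[, continuous (g z)}) ->
  (forall j m : nat, measurable_fun D (g ^~ (j%:R / m.+1%:R))) ->
  measurable_fun D (fun z => g z (u z)).
Proof.
move=> mD mu u0 cg mg.
pose x (m : nat) z : R := (Num.truncn (u z * m.+1%:R))%:R / m.+1%:R.
apply: (@measurable_fun_cvg _ _ _ _ (fun m z => g z (x m z))) => [m|z Dz].
  move=> _ B mB.
  rewrite (_ : D `&` _ = \bigcup_j (
      (D `&` (fun z => u z * m.+1%:R) @^-1` `[j%:R, j.+1%:R[) `&`
      (D `&` (g ^~ (j%:R / m.+1%:R)) @^-1` B))).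
    apply: bigcupT_measurable => j; apply: measurableI; last exact: mg.
    apply: measurable_funM => //; exact: measurable_cst.
  apply/seteqP; split=> [z [Dz Bz]|z [j _ [[Dz jz] [_ Bz]]]].
    exists (Num.truncn (u z * m.+1%:R)) => //; split; split=> //=.
    by rewrite in_itv/=; apply: truncn_itv; rewrite mulr_ge0// u0.
  split=> //; rewrite /= /x.
  have /eqP -> // : Num.truncn (u z * m.+1%:R) == j.
  by rewrite truncn_eq ?mulr_ge0 ?u0//; move: jz; rewrite /= in_itv.
have x0 m : 0 <= x m z by rewrite divr_ge0.
have xu : (x ^~ z) @ \oo --> u z.
  apply/cvgrPdist_lt => e e0; near=> m.
  have /truncn_itv/andP[t1 t2] : 0 <= u z * m.+1%:R by rewrite mulr_ge0// u0.
  have m0 : 0 < m.+1%:R :> R by [].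
  have x1 : x m z <= u z by rewrite ler_pdivrMr.
  have x2 : u z < x m z + m.+1%:R^-1.
    by rewrite -[_^-1]mul1r -mulrDl ltr_pdivlMr// natr1.
  have me : m.+1%:R^-1 < e by near: m; exact: (near_infty_natSinv_lt (PosNum e0)).
  by rewrite ger0_norm ?subr_ge0// (lt_trans _ me)// ltrBlDl.
have /subspace_continuousP/(_ (u z)) := cg z Dz.
rewrite /= in_itv/= andbT u0// => /(_ isT) gu.
apply: (@cvg_comp _ _ _ (x ^~ z) (g z) _ _ _ _ gu) => P wP.
have : \forall m \near \oo, `[0, +oo[%classic (x m z) -> P (x m z) by exact: xu wP.
by apply: filterS => m /= h; apply: h; rewrite in_itv/= andbT.
Unshelve. all: by end_near. Qed.

(** * The p-energy and the flux |G|^(p-2) G *)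

Section euclidean_norm.
Context {R : realType} {m : nat}.
Implicit Types v w : 'rV[R]_m.

Lemma dotvC v w : dotv v w = dotv w v.
Proof. by apply: eq_bigr => i _; rewrite mulrC. Qed.

Lemma dotvDr v w w' : dotv v (w + w') = dotv v w + dotv v w'.
Proof. by rewrite -big_split; apply: eq_bigr => i _; rewrite mxE mulrDr. Qed.

Lemma dotvZr (a : R) v w : dotv v (a *: w) = a * dotv v w.
Proof. by rewrite mulr_sumr; apply: eq_bigr => i _; rewrite mxE mulrCA. Qed.

Lemma dotvNr v w : dotv v (- w) = - dotv v w.
Proof. by rewrite -scaleN1r dotvZr mulN1r. Qed.

Lemma dotvv_ge0 v : 0 <= dotv v v.
Proof. by apply: sumr_ge0 => i _; rewrite -expr2 sqr_ge0. Qed.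

Lemma enorm_ge0 v : 0 <= enorm v.
Proof. exact: sqrtr_ge0. Qed.

Lemma enorm_sqr v : enorm v ^+ 2 = dotv v v.
Proof. by rewrite sqr_sqrtr// dotvv_ge0. Qed.

Lemma enorm_eq0 v : enorm v = 0 -> v = 0.
Proof.
move=> v0; apply/rowP => i; rewrite mxE.
have : dotv v v == 0 by rewrite -enorm_sqr v0 expr0n.
rewrite psumr_eq0 => [/allP/(_ i (mem_index_enum _))|j _]; last first.
  by rewrite -expr2 sqr_ge0.
by rewrite /= -expr2 sqrf_eq0 => /eqP.
Qed.

Lemma enorm0 : enorm (0 : 'rV[R]_m) = 0.
Proof. by rewrite /enorm /dotv big1 ?sqrtr0// => i _; rewrite mxE mul0r. Qed.

Lemma enormN v : enorm (- v) = enorm v.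
Proof. by rewrite /enorm dotvNr dotvC dotvNr opprK. Qed.

Lemma dotv_le v w : dotv v w <= enorm v * enorm w.
Proof.
have [v0|v0] := eqVneq (enorm v) 0.
  rewrite (enorm_eq0 v0) enorm0 mul0r /dotv big1// => i _.
  by rewrite mxE mul0r.
have {}v0 : 0 < enorm v by rewrite lt_def v0 enorm_ge0.
have := dotvv_ge0 ((enorm v) *: w + (- enorm w) *: v).
rewrite dotvDr !dotvZr ![dotv (_ + _) _]dotvC !dotvDr !dotvZr (dotvC w v).
rewrite -!enorm_sqr => h.
have [w0|w0] := eqVneq (enorm w) 0.
  by rewrite (enorm_eq0 w0) enorm0 mulr0 /dotv big1// => i _; rewrite mxE mulr0.
have {}w0 : 0 < enorm w by rewrite lt_def w0 enorm_ge0.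
rewrite -(ler_pM2l (mulr_gt0 v0 w0)); lra.
Qed.

Lemma normr_dotv_le v w : `|dotv v w| <= enorm v * enorm w.
Proof.
rewrite ler_norml dotv_le andbT -lerN2 opprK -dotvNr.
by rewrite (le_trans (dotv_le _ _))// enormN.
Qed.

Lemma enormD v w : enorm (v + w) <= enorm v + enorm w.
Proof.
rewrite -ler_sqr ?nnegrE ?addr_ge0 ?enorm_ge0// enorm_sqr.
rewrite dotvDr ![dotv (_ + _) _]dotvC !dotvDr (dotvC w v) sqrrD -!enorm_sqr.
have := dotv_le v w; lra.
Qed.

End euclidean_norm.

(** * Real powers: Young's inequality and continuity *)

Section powR_extra.
Context {R : realType}.

Lemma young_powR (p a b : R) : 1 < p -> 0 <= a -> 0 <= b ->
  p * (a `^ (p - 1) * b) <= b `^ p + (p - 1) * a `^ p.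
Proof.
move=> p1 a0 b0.
have p0 : 0 < p by rewrite (lt_trans _ p1).
have q0 : 0 < p - 1 by rewrite subr_gt0.
have := @conjugate_powR _ b (a `^ (p - 1)) p (p / (p - 1)) b0 (powR_ge0 _ _) p0
  (divr_gt0 p0 q0).
have -> : p^-1 + (p / (p - 1))^-1 = 1 by field; rewrite !gt_eqF.
move=> /(_ erefl); rewrite -powRrM.
have -> : (p - 1) * (p / (p - 1)) = p by field; rewrite gt_eqF.
rewrite mulrC -(ler_pM2l p0) => /le_trans; apply.
rewrite le_eqVlt; apply/orP; left; apply/eqP.
by field; rewrite !gt_eqF.
Qed.

Lemma continuous_powR_pos (r a : R) : 0 < a -> {for a, continuous (@powR R ^~ r)}.
Proof.
by move=> a0; have [/derivable1_diffP/differentiable_continuous] :=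
  @is_derive1_powR R r a a0.
Qed.

Lemma cvg_powR (r a : R) (x : nat -> R) : 0 < a ->
  x @ \oo --> a -> (fun k => x k `^ r) @ \oo --> a `^ r.
Proof.
move=> a0 xa; apply: (@cvg_comp _ _ _ x (@powR R ^~ r) _ _ _ xa).
exact: continuous_powR_pos.
Qed.

(** At a positive limit the power is differentiable; at 0 the comparison x^p <= x for 0 < x <= 1
    takes over. *)
Lemma cvg_powR_ge1 (p a : R) (x : nat -> R) : 1 <= p -> (forall k, 0 <= x k) ->
  x @ \oo --> a -> (fun k => x k `^ p) @ \oo --> a `^ p.
Proof.
move=> p1 x0 xa.
have : 0 <= a.
  by rewrite -(cvg_lim _ xa)//; apply: limr_ge; [exact: cvgP xa|exact: nearW].
rewrite le_eqVlt => /predU1P[a0|a0]; last exact: cvg_powR.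
rewrite -{}a0 in xa *; rewrite powR0; last by rewrite gt_eqF// (lt_le_trans _ p1).
apply: (@squeeze_cvgr _ _ _ _ (fun=> 0) x) => //; last exact: cvg_cst.
near=> k; rewrite powR_ge0/=.
have := x0 k; rewrite le_eqVlt => /predU1P[<-|xk].
  by rewrite powR0// gt_eqF// (lt_le_trans _ p1).
apply: ge1r_powR => //; rewrite xk/=; near: k.
by apply: (cvgr_le 0) => //.
Unshelve. all: by end_near. Qed.

End powR_extra.

(** * Inequalities of Hoelder and Minkowski on a measurable set *)

Section Lp_on_a_set.
Context d (T : measurableType d) (R : realType).
Variables (mu : {measure set T -> \bar R}) (D : set T).
Hypothesis mD : measurable D.
Implicit Types f g : T -> R.

Local Notation Nm p f := ('N[mu]_p%:E[(EFin \o f) \_ D])%E.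

Lemma measurable_fun_powR f (r : R) :
  measurable_fun D f -> measurable_fun D (fun x => f x `^ r).
Proof. exact: (@measurableT_comp _ _ _ _ _ _ (@powR R ^~ r)). Qed.

(** Off [D] the restriction [f \_ D] takes the value [point]; this makes it an extension by zero, so
    that it commutes with sums and products. *)
Lemma point_real : (point : R) = 0. Proof. by []. Qed.

Lemma EFin_patch f : (EFin \o f) \_ D = EFin \o (f \_ D).
Proof. by apply/funext => x; rewrite /= !patchE; case: ifP. Qed.

Lemma Lnorm_setE (p : R) f : p != 0 ->
  (Nm p f `^ p = \int[mu]_(x in D) (`|f x| `^ p)%:E)%E.
Proof.
move=> p0; rewrite poweR_Lnorm// [RHS]integral_mkcond.
apply: eq_integral => x _; rewrite /= !patchE; case: ifP => // _.
by rewrite abse0 poweR0r.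
Qed.

Lemma measurable_patch f : measurable_fun D f -> measurable_fun setT (f \_ D).
Proof. by move=> mf; apply: (measurable_restrictT _ mD).1. Qed.

Lemma hoelder_set f g (p q : R) :
  measurable_fun D f -> measurable_fun D g -> 0 < p -> 0 < q ->
  p^-1 + q^-1 = 1 ->
  (\int[mu]_(x in D) `|(f x * g x)%:E| <= Nm p f * Nm q g)%E.
Proof.
move=> mf mg p0 q0 pq; rewrite !EFin_patch.
apply: le_trans (hoelder mu (measurable_patch mf) (measurable_patch mg) p0 q0 pq).
rewrite Lnorm1 [leLHS]integral_mkcond le_eqVlt; apply/orP; left; apply/eqP.
apply: eq_integral => x _; rewrite !patchE/= !patchE; case: ifP => // _.
by rewrite point_real mulr0 normr0.
Qed.

Lemma minkowski_set f g (p : R) :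
  measurable_fun D f -> measurable_fun D g -> 1 <= p ->
  (Nm p (fun x => f x + g x)%R <= Nm p f + Nm p g)%E.
Proof.
move=> mf mg p1; rewrite !EFin_patch.
apply: le_trans (minkowski_EFin mu (measurable_patch mf) (measurable_patch mg) p1).
rewrite le_eqVlt; apply/orP; left; apply/eqP; apply: eq_Lnorm => x /=.
by rewrite !patchE; case: ifP => // _; rewrite point_real addr0.
Qed.

Lemma le_Lnorm_set f g (p : R) : 0 < p -> measurable_fun D f ->
  measurable_fun D g -> (forall x, D x -> `|f x| <= `|g x|) ->
  (Nm p f <= Nm p g)%E.
Proof.
move=> p0 mf mg fg.
have mp (h : T -> R) : measurable_fun D h ->
    measurable_fun D (fun x => (`|h x| `^ p)%:E).
  move=> mh; apply/measurable_EFinP.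
  by apply: measurable_fun_powR; exact: measurableT_comp.
have h : (Nm p f `^ p <= Nm p g `^ p)%E.
  rewrite !(Lnorm_setE _ (lt0r_neq0 p0)); apply: ge0_le_integral => //.
  - exact: mp.
  - exact: mp.
  - move=> x Dx; rewrite lee_fin; apply: ge0_ler_powR; rewrite ?nnegrE//.
      exact: ltW.
    exact: fg.
have := @gt0_ler_poweR _ p^-1; rewrite invr_ge0 => /(_ (ltW p0)) mono.
have := mono _ _ _ _ h; rewrite !in_itv/= !leey !poweR_ge0 => /(_ isT isT).
by rewrite -!poweRrM !divff ?gt_eqF// !poweRe1 ?Lnorm_ge0.
Qed.

End Lp_on_a_set.

Section p_energy.
Context d (T : measurableType d) (R : realType).
Variables (mu : {measure set T -> \bar R}) (D : set T).
Hypothesis mD : measurable D.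
Variables (m : nat) (p : R).
Hypothesis p1 : 1 < p.
Implicit Types (X Y : T -> 'rV[R]_m) (a : T -> R).

Let p0 : 0 < p. Proof. exact: lt_trans p1. Qed.

Let pN0 : p != 0. Proof. by rewrite gt_eqF. Qed.

Let pB1 : 0 < p - 1. Proof. by rewrite subr_gt0. Qed.

Let q := p / (p - 1).

Let q0 : 0 < q. Proof. exact: divr_gt0. Qed.

Let qp : q^-1 + p^-1 = 1. Proof. by rewrite /q; field; rewrite !gt_eqF. Qed.

Definition vmeasurable X := forall i, measurable_fun D (fun z => X z ord0 i).

Definition energy_norm X : \bar R :=
  ('N[mu]_p%:E[(EFin \o (fun z => enorm (X z))) \_ D])%E.

Lemma vmeasurableD X Y : vmeasurable X -> vmeasurable Y ->
  vmeasurable (fun z => X z + Y z).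
Proof.
move=> mX mY i; under eq_fun do rewrite mxE.
exact: measurable_funD.
Qed.

Lemma vmeasurableN X : vmeasurable X -> vmeasurable (fun z => - X z).
Proof.
move=> mX i; under eq_fun do rewrite mxE.
exact: measurable_funN.
Qed.

Lemma vmeasurableB X Y : vmeasurable X -> vmeasurable Y ->
  vmeasurable (fun z => X z - Y z).
Proof. by move=> mX mY; apply: vmeasurableD => //; exact: vmeasurableN. Qed.

Lemma measurable_dotv X Y : vmeasurable X -> vmeasurable Y ->
  measurable_fun D (fun z => dotv (X z) (Y z)).
Proof.
by move=> mX mY; apply: measurable_sum => i; exact: measurable_funM.
Qed.

Lemma measurable_enorm X : vmeasurable X ->
  measurable_fun D (fun z => enorm (X z)).
Proof.
move=> mX; apply: (measurableT_comp (f := @Num.sqrt R)).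
  exact: continuous_measurable_fun (@sqrt_continuous R).
exact: measurable_dotv.
Qed.

Lemma energyE X : (energy_norm X `^ p =
  \int[mu]_(z in D) (enorm (X z) `^ p)%:E)%E.
Proof.
rewrite /energy_norm (Lnorm_setE _ _ _ pN0); apply: eq_integral => z _.
by rewrite ger0_norm// enorm_ge0.
Qed.

Lemma energy_norm_ge0 X : (0 <= energy_norm X)%E.
Proof. exact: Lnorm_ge0. Qed.

Lemma energy_normD X Y : vmeasurable X -> vmeasurable Y ->
  (energy_norm (fun z => X z + Y z)%R <= energy_norm X + energy_norm Y)%E.
Proof.
move=> mX mY; have mX' := measurable_enorm mX; have mY' := measurable_enorm mY.
apply: le_trans (minkowski_set mu mD mX' mY' (ltW p1)).
apply: le_Lnorm_set => //.
- exact: measurable_enorm (vmeasurableD mX mY).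
- exact: measurable_funD.
- move=> z _; rewrite !ger0_norm ?addr_ge0 ?enorm_ge0//; exact: enormD.
Qed.

Variable G : T -> 'rV[R]_m.
Hypothesis mG : vmeasurable G.
Hypothesis Goo : (energy_norm G < +oo)%E.

Definition pflux X z := enorm (G z) `^ (p - 2) * dotv (G z) (X z).

Lemma pfluxD X Y z : pflux (fun z => X z + Y z) z = pflux X z + pflux Y z.
Proof. by rewrite /pflux dotvDr mulrDr. Qed.

Lemma pflux_self z : pflux G z = enorm (G z) `^ p.
Proof.
rewrite /pflux -enorm_sqr; have [->|g0] := eqVneq (enorm (G z)) 0.
  by rewrite expr0n mulr0 powR0.
rewrite -powR_mulrn ?enorm_ge0// -powRD; last by rewrite g0 implybT.
by rewrite subrK.
Qed.

Lemma normr_pflux_le X z :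
  `|pflux X z| <= enorm (G z) `^ (p - 1) * enorm (X z).
Proof.
rewrite /pflux normrM (ger0_norm (powR_ge0 _ _)).
have [g0|g0] := eqVneq (enorm (G z)) 0.
  rewrite (enorm_eq0 g0) /dotv big1 ?normr0 ?mulr0 ?mulr_ge0 ?powR_ge0 ?enorm_ge0//.
  by move=> i _; rewrite mxE mul0r.
apply: (@le_trans _ _ (enorm (G z) `^ (p - 2) * (enorm (G z) * enorm (X z)))).
  by rewrite ler_wpM2l ?powR_ge0// normr_dotv_le.
rewrite mulrA ler_wpM2r ?enorm_ge0// -{2}(powRr1 (enorm_ge0 (G z))) -powRD.
  by rewrite le_eqVlt; apply/orP; left; apply/eqP; congr (_ `^ _); ring.
by rewrite g0 implybT.
Qed.

Lemma measurable_pflux X : vmeasurable X -> measurable_fun D (pflux X).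
Proof.
move=> mX; apply: measurable_funM; last exact: measurable_dotv.
by apply: measurable_fun_powR; exact: measurable_enorm.
Qed.

Let Gq : \bar R := ('N[mu]_q%:E[(EFin \o (fun z => enorm (G z) `^ (p - 1))%R) \_ D])%E.

(** Since [(p - 1) * q = p], the q-th power of this norm is the p-energy of [G]. *)
Let Gq_fin : (Gq \is a fin_num).
Proof.
rewrite ge0_fin_numE ?Lnorm_ge0//; apply: (@lty_poweRy _ _ q); first by rewrite gt_eqF.
rewrite /Gq Lnorm_setE ?gt_eqF//.
under eq_integral do rewrite ger0_norm ?powR_ge0// -powRrM.
have -> : (p - 1) * q = p by rewrite /q; field; rewrite gt_eqF.
by rewrite -energyE poweR_lty.
Qed.

Lemma pflux_hoelder a X (C : R) : measurable_fun D a -> vmeasurable X ->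
  0 <= C -> (forall z, D z -> `|a z| <= C) ->
  (\int[mu]_(z in D) `|(a z * pflux X z)%:E| <= C%:E * (Gq * energy_norm X))%E.
Proof.
move=> ma mX C0 aC; have mGp : measurable_fun D (fun z => enorm (G z) `^ (p - 1)).
  by apply: measurable_fun_powR; exact: measurable_enorm.
have mX' := measurable_enorm mX.
have /(lee_wpmul2l _) := hoelder_set mu mD mGp mX' q0 p0 qp.
move=> /(_ C%:E); rewrite lee_fin => /(_ C0); apply: le_trans.
have mprod : measurable_fun D (fun z => `|(enorm (G z) `^ (p - 1) * enorm (X z))%R%:E|)%E.
  apply: measurableT_comp => //; apply/measurable_EFinP; exact: measurable_funM.
rewrite -ge0_integralZl_EFin//; apply: ge0_le_integral => //.
- apply: measurableT_comp => //; apply/measurable_EFinP; apply: measurable_funM => //.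
  exact: measurable_pflux.
- exact: measurable_funeM.
move=> z Dz; rewrite lee_fin normrM (ger0_norm (mulr_ge0 (powR_ge0 _ _) (enorm_ge0 _))).
by rewrite ler_pM// ?aC// normr_pflux_le.
Qed.

Lemma pflux_integrable a X (C : R) : measurable_fun D a -> vmeasurable X ->
  0 <= C -> (forall z, D z -> `|a z| <= C) -> (energy_norm X < +oo)%E ->
  mu.-integrable D (EFin \o (fun z => a z * pflux X z)).
Proof.
move=> ma mX C0 aC Xoo; apply/integrableP; split.
  by apply/measurable_EFinP; apply: measurable_funM => //; exact: measurable_pflux.
apply: le_lt_trans (pflux_hoelder ma mX C0 aC) _.
rewrite -ge0_fin_numE ?mule_ge0 ?lee_fin ?energy_norm_ge0 ?Lnorm_ge0//.
by rewrite !fin_numM// ge0_fin_numE ?energy_norm_ge0.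
Qed.

Lemma energy_normB_lty X Y : vmeasurable X -> vmeasurable Y ->
  (energy_norm X < +oo)%E -> (energy_norm Y < +oo)%E ->
  (energy_norm (fun z => X z - Y z)%R < +oo)%E.
Proof.
move=> mX mY Xoo Yoo; apply: le_lt_trans (energy_normD mX (vmeasurableN mY)) _.
rewrite lte_add_pinfty//; apply: le_lt_trans Yoo.
rewrite le_eqVlt; apply/orP; left; apply/eqP.
by rewrite /energy_norm; congr ('N[_]__[_ \_ _])%E; apply/funext => z /=; rewrite enormN.
Qed.

(* Only the field needs Hoelder's inequality; the bounded coefficient is handled
   by dominated convergence. *)
Lemma pflux_cvg (a_ : nat -> T -> R) a (X_ : nat -> T -> 'rV[R]_m) X (C : R) :
  (forall k, measurable_fun D (a_ k)) -> measurable_fun D a ->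
  (forall k, vmeasurable (X_ k)) -> vmeasurable X ->
  0 <= C -> (forall k z, D z -> `|a_ k z| <= C) ->
  (forall z, D z -> a_ ^~ z @ \oo --> a z) ->
  (energy_norm X < +oo)%E -> (forall k, (energy_norm (X_ k) < +oo)%E) ->
  energy_norm (fun z => X_ k z - X z) @[k --> \oo] --> 0%E ->
  (\int[mu]_(z in D) (a_ k z * pflux (X_ k) z)%:E @[k --> \oo] -->
   \int[mu]_(z in D) (a z * pflux X z)%:E)%E.
Proof.
move=> ma_ ma mX_ mX C0 aC aa Xoo X_oo XX.
have mXX k : vmeasurable (fun z => X_ k z - X z) by exact: vmeasurableB.
have i1 k : mu.-integrable D
    (EFin \o (fun z => a_ k z * pflux (fun z => X_ k z - X z) z)).
  by apply: (pflux_integrable _ _ C0); rewrite ?energy_normB_lty//; exact: aC.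
have i2 k : mu.-integrable D (EFin \o (fun z => a_ k z * pflux X z)).
  by apply: (pflux_integrable _ _ C0) => //; exact: aC.
have E k : (\int[mu]_(z in D) (a_ k z * pflux (X_ k) z)%:E =
    \int[mu]_(z in D) (a_ k z * pflux (fun z => (X_ k z - X z)%R) z)%:E +
    \int[mu]_(z in D) (a_ k z * pflux X z)%:E)%E.
  rewrite -(integralD_EFin mD (i1 k) (i2 k)); apply: eq_integral => z _ /=.
  by rewrite -EFinD -mulrDr -pfluxD; congr (_ * _)%:E; rewrite /pflux subrK.
rewrite (eq_cvg _ _ E).
have c1 : (\int[mu]_(z in D) (a_ k z * pflux (fun z => (X_ k z - X z)%R) z)%:E
    @[k --> \oo] --> 0)%E.
  apply/cvg_abse0P; apply: (@squeeze_cvge _ _ _ _ (fun=> 0%E) _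
      (fun k => C%:E * (Gq * energy_norm (fun z => (X_ k z - X z)%R))))%E.
  - apply: nearW => k; rewrite abse_ge0/=.
    apply: le_trans (pflux_hoelder (ma_ k) (mXX k) C0 (aC k)).
    by apply: le_abse_integral => //; have /integrableP[] := i1 k.
  - exact: cvg_cst.
  - rewrite -[X in _ --> X](mule0 C%:E) -[X in _ --> (_ * X)%E](mule0 Gq).
    by apply: cvgeZl => //; exact: cvgeZl.
have c2 : (\int[mu]_(z in D) (a_ k z * pflux X z)%:E @[k --> \oo] -->
    \int[mu]_(z in D) (a z * pflux X z)%:E)%E.
  have mpX := measurable_pflux mX.
  have [] := @dominated_convergence _ _ _ mu _ mD
    (fun k z => (a_ k z * pflux X z)%:E) (fun z => (a z * pflux X z)%:E)
    (fun z => (C * `|pflux X z|)%:E) => //.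
  - by move=> k; apply/measurable_EFinP; exact: measurable_funM.
  - by apply/measurable_EFinP; exact: measurable_funM.
  - apply: aeW => z Dz; apply: cvg_EFin; first exact: nearW.
    by apply: cvgMl; exact: aa.
  - have /integrable_abse : mu.-integrable D (EFin \o (fun z => C * pflux X z)).
      by apply: (@pflux_integrable (fun=> C) _ C) => // z _; rewrite ger0_norm.
    apply: eq_integrable => // z _ /=; by rewrite normrM ger0_norm.
  - apply: aeW => z k Dz; rewrite lee_fin normrM.
    by rewrite ler_wpM2r// aC.
have := cvgeD _ c1 c2; rewrite add0e; apply.
by rewrite fin_num_adde_defr.
Qed.

(** The triangle inequality, used in both directions, bounds the difference of the norms by the norm
    [dd k] of the difference; the p-th power is then continuous. *)
Lemma cvg_energy (X_ : nat -> T -> 'rV[R]_m) X :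
  (forall k, vmeasurable (X_ k)) -> vmeasurable X ->
  (energy_norm X < +oo)%E -> (forall k, (energy_norm (X_ k) < +oo)%E) ->
  energy_norm (fun z => X_ k z - X z) @[k --> \oo] --> 0%E ->
  (\int[mu]_(z in D) (enorm (X_ k z) `^ p)%:E @[k --> \oo] -->
   \int[mu]_(z in D) (enorm (X z) `^ p)%:E)%E.
Proof.
move=> mX_ mX Xoo X_oo XX.
have mXX k : vmeasurable (fun z => X_ k z - X z) by exact: vmeasurableB.
have fin Y : (energy_norm Y < +oo)%E -> energy_norm Y = (fine (energy_norm Y))%:E.
  by move=> Yoo; rewrite fineK// ge0_fin_numE ?energy_norm_ge0.
pose dd k := fine (energy_norm (fun z => X_ k z - X z)).
have ddE k : energy_norm (fun z => X_ k z - X z) = (dd k)%:E.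
  by rewrite fin// energy_normB_lty.
have dd0 : dd @ \oo --> (0 : R).
  by move/fine_cvgP : XX => [].
have le1 k : fine (energy_norm (X_ k)) <= fine (energy_norm X) + dd k.
  rewrite -lee_fin EFinD -ddE -!fin//.
  rewrite [leLHS](_ : _ = energy_norm (fun z => X z + (X_ k z - X z))).
    exact: energy_normD.
  by congr energy_norm; apply/funext => z; rewrite addrC subrK.
have le2 k : fine (energy_norm X) <= fine (energy_norm (X_ k)) + dd k.
  rewrite -lee_fin EFinD -ddE -!fin//.
  rewrite [leLHS](_ : _ = energy_norm (fun z => X_ k z + - (X_ k z - X z))).
    apply: le_trans (energy_normD _ (vmeasurableN (mXX k))) _ => //.
    rewrite leeD2l// le_eqVlt; apply/orP; left; apply/eqP.
    rewrite /energy_norm; congr ('N[_]__[_ \_ _])%E.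
    by apply/funext => z /=; rewrite enormN.
  by congr energy_norm; apply/funext => z; rewrite opprB addrC subrK.
have c : fine (energy_norm (X_ k)) @[k --> \oo] --> fine (energy_norm X).
  apply/cvgrPdist_le => e e0; near=> k.
  have dk : dd k <= e by near: k; exact: (cvgr_le 0 dd0).
  by rewrite ler_distlC lerBlDr (le_trans (le2 k)) ?lerD2l// (le_trans (le1 k)) ?lerD2l.
have EE Y : (energy_norm Y < +oo)%E ->
    (\int[mu]_(z in D) (enorm (Y z) `^ p)%:E = (fine (energy_norm Y) `^ p)%:E)%E.
  by move=> Yoo; rewrite -energyE fin//= poweR_EFin.
rewrite EE// (eq_cvg _ _ (fun k => EE _ (X_oo k))).
apply: cvg_EFin; first exact: nearW.
apply: cvg_powR_ge1 => //; first exact: ltW.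
by move=> k; rewrite fine_ge0// energy_norm_ge0.
Unshelve. all: by end_near. Qed.

End p_energy.

(** * Enlarging the class of test functions *)

Section test_by_nonsmooth_functions.
Context {R : realType} {n : nat}.
Local Notation H := (heisenberg R n).
Local Notation mu := (@heisenberg_measure R n).
Variables (p : R) (Omega D : set H).
Hypotheses (p1 : 1 < p) (mD : measurable D).
Local Notation energy := (energy_norm mu D p).

Lemma smooth_measurable (phi : H -> R) : smooth phi -> measurable_fun D phi.
Proof.
by move=> sphi; apply: measurable_funTS; apply: continuous_measurable_rV;
  exact: smooth_continuous.
Qed.

Lemma vmeasurable_hgrad (phi : H -> R) : smooth phi -> vmeasurable D (hgrad phi).
Proof.
move=> sphi i.
have mc j : measurable_fun D (fun z : H => z ord0 j).
  by apply: measurable_funTS; exact: measurable_rV_coord.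
have mp j : measurable_fun D (partial j phi).
  by apply: smooth_measurable; exact: smooth_partial.
rewrite -(fintype.splitK i); case: (fintype.split i) => j /=.
  under eq_fun do rewrite /hgrad row_mxEl mxE.
  apply: measurable_funD; first exact: mp.
  apply: measurable_funM; last exact: mp.
  by apply: measurable_funM; [exact: measurable_cst|exact: mc].
under eq_fun do rewrite /hgrad row_mxEr mxE.
apply: measurable_funB; first exact: mp.
apply: measurable_funM; last exact: mp.
by apply: measurable_funM; [exact: measurable_cst|exact: mc].
Qed.

(* [D] will be [Omega] minus a null set, chosen so that the almost everywhere
   properties hold at every point of [D]. *)
Record solution_on (F u : H -> R) (G : H -> 'rV[R]_(n + n)) (psi : nat -> H -> R)
    : Prop := SolutionOn {
  sol_mu : measurable_fun D u;
  sol_u_gt0 : forall z, D z -> 0 < u z;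
  sol_mF : measurable_fun D F;
  sol_F_gt0 : forall z, D z -> 0 < F z;
  sol_mG : vmeasurable D G;
  sol_Goo : (energy G < +oo)%E;
  sol_test : forall k, test_function Omega (psi k);
  sol_psioo : forall k, (energy (hgrad (psi k)) < +oo)%E;
  sol_cvgG : energy (fun z => hgrad (psi k) z - G z) @[k --> \oo] --> 0%E;
  sol_cvg : forall z, D z -> psi ^~ z @ \oo --> u z;
  sol_eq : forall phi, test_function Omega phi ->
    (\int[mu]_(z in D) (pflux p G (hgrad phi) z)%:E =
     \int[mu]_(z in D) (F z * phi z)%:E)%E }.

Lemma sol_mpsi F u G psi k : solution_on F u G psi -> vmeasurable D (hgrad (psi k)).
Proof. by move=> s; have [sp _ _] := sol_test s k; exact: vmeasurable_hgrad. Qed.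

Lemma energy_norm_cst0 : energy (fun=> 0 : 'rV[R]_(n + n)) = 0%E.
Proof.
rewrite /energy_norm (_ : _ \_ _ = cst 0%E) ?Lnorm0//.
  by rewrite eqe gt_eqF// (lt_trans _ p1).
by apply/funext => z; rewrite patchE /= enorm0; case: ifP.
Qed.

(* The possibly nonsmooth function [w] of [u] and [phi] is an admissible test
   function. The right-hand side is dominated by [F B], which is integrable by the
   equation tested with [B]. *)
Lemma test_limit F u G psi (phi : H -> R) (w_ : nat -> H -> R) (w : H -> R)
    (a_ b_ : nat -> H -> R) (a b : H -> R) (B beta : H -> R) (C : R) :
  solution_on F u G psi ->
  test_function Omega phi -> (energy (hgrad phi) < +oo)%E ->
  0 <= C ->
  (forall k, test_function Omega (w_ k)) ->
  (forall k z, hgrad (w_ k) z = a_ k z *: hgrad (psi k) z + b_ k z *: hgrad phi z) ->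
  (forall k, measurable_fun D (a_ k)) -> (forall k, measurable_fun D (b_ k)) ->
  (forall k z, D z -> `|a_ k z| <= C) -> (forall k z, D z -> `|b_ k z| <= C) ->
  (forall z, D z -> a_ ^~ z @ \oo --> a z) ->
  (forall z, D z -> b_ ^~ z @ \oo --> b z) ->
  (forall z, D z -> w_ ^~ z @ \oo --> w z) ->
  test_function Omega B ->
  (forall z, hgrad B z = beta z *: hgrad phi z) ->
  measurable_fun D beta -> (forall z, D z -> `|beta z| <= C) ->
  (forall k z, D z -> `|w_ k z| <= B z) ->
  (\int[mu]_(z in D) (a z * pflux p G G z)%:E +
   \int[mu]_(z in D) (b z * pflux p G (hgrad phi) z)%:E =
   \int[mu]_(z in D) (F z * w z)%:E)%E.
Proof.
move=> sol tphi phioo C0 tw wE ma_ mb_ aC bC aa bb ww tB BE mbeta betaC wB.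
have [sphi _ _] := tphi; have mphi := vmeasurable_hgrad sphi.
have mG := sol_mG sol; have Goo := sol_Goo sol; have mF := sol_mF sol.
have ma : measurable_fun D a by exact: measurable_fun_cvg ma_ aa.
have mb : measurable_fun D b by exact: measurable_fun_cvg mb_ bb.
have mw : measurable_fun D w.
  by apply: measurable_fun_cvg ww => k; have [sw _ _] := tw k; exact: smooth_measurable.
have ca := pflux_cvg mD p1 mG Goo ma_ ma (fun k => sol_mpsi k sol) mG C0 aC aa Goo
  (sol_psioo sol) (sol_cvgG sol).
have cb : (\int[mu]_(z in D) (b_ k z * pflux p G (hgrad phi) z)%:E @[k --> \oo] -->
    \int[mu]_(z in D) (b z * pflux p G (hgrad phi) z)%:E)%E.
  apply: (pflux_cvg mD p1 mG Goo mb_ mb (fun=> mphi) mphi C0 bC bb phioo (fun=> phioo)).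
  under eq_fun do under [X in energy X]eq_fun do rewrite subrr.
  by rewrite energy_norm_cst0; exact: cvg_cst.
have ia k : mu.-integrable D (EFin \o (fun z => a_ k z * pflux p G (hgrad (psi k)) z)).
  exact: (pflux_integrable mD p1 mG Goo (ma_ k) (sol_mpsi k sol) C0 (aC k)
    (sol_psioo sol k)).
have ib k : mu.-integrable D (EFin \o (fun z => b_ k z * pflux p G (hgrad phi) z)).
  exact: (pflux_integrable mD p1 mG Goo (mb_ k) mphi C0 (bC k) phioo).
have ib' : mu.-integrable D (EFin \o (fun z => b z * pflux p G (hgrad phi) z)).
  apply: (pflux_integrable mD p1 mG Goo mb mphi C0 _ phioo) => z Dz.
  rewrite ler_norml; apply/andP; split.
    rewrite -(cvg_lim _ (bb z Dz))//; apply: limr_ge; first exact: cvgP (bb z Dz).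
    by apply: nearW => k; have := bC k z Dz; rewrite ler_norml => /andP[].
  rewrite -(cvg_lim _ (bb z Dz))//; apply: limr_le; first exact: cvgP (bb z Dz).
  by apply: nearW => k; have := bC k z Dz; rewrite ler_norml => /andP[].
have pE (f g : H -> R) (V W : H -> 'rV[R]_(n + n)) z :
    pflux p G (fun z => f z *: V z + g z *: W z) z =
    f z * pflux p G V z + g z * pflux p G W z.
  by rewrite /pflux dotvDr !dotvZr mulrDr; congr (_ + _); rewrite mulrCA.
have E k : (\int[mu]_(z in D) (a_ k z * pflux p G (hgrad (psi k)) z)%:E +
    \int[mu]_(z in D) (b_ k z * pflux p G (hgrad phi) z)%:E =
    \int[mu]_(z in D) (F z * w_ k z)%:E)%E.
  rewrite -(sol_eq sol (tw k)) -(integralD_EFin mD (ia k) (ib k)).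
  apply: eq_integral => z _ /=; congr (_%:E); rewrite -pE.
  by rewrite /pflux wE.
have iFB : mu.-integrable D (fun z => (F z * B z)%:E).
  have [sB _ _] := tB.
  have mFB : measurable_fun D (fun z => (F z * B z)%:E).
    by apply/measurable_EFinP; apply: measurable_funM => //; exact: smooth_measurable.
  have B0 z : D z -> 0 <= B z by move=> Dz; exact: le_trans (normr_ge0 _) (wB 0%N z Dz).
  apply/integrableP; split=> //.
  under eq_integral => z /set_mem Dz.
    rewrite gee0_abs; last by rewrite lee_fin mulr_ge0 ?B0// ltW// (sol_F_gt0 sol).
    over.
  rewrite -(sol_eq sol tB).
  have : mu.-integrable D (EFin \o (fun z => beta z * pflux p G (hgrad phi) z)).
    exact: (pflux_integrable mD p1 mG Goo mbeta mphi C0 betaC).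
  move=> /(integrable_fin_num mD); rewrite fin_numElt => /andP[_].
  apply: le_lt_trans; rewrite le_eqVlt; apply/orP; left; apply/eqP.
  by apply: eq_integral => z _; rewrite /= /pflux BE dotvZr mulrCA.
have cF : (\int[mu]_(z in D) (F z * w_ k z)%:E @[k --> \oo] -->
    \int[mu]_(z in D) (F z * w z)%:E)%E.
  have [] // := @dominated_convergence _ _ _ mu _ mD
    (fun k z => (F z * w_ k z)%:E) (fun z => (F z * w z)%:E) _ _ _ _ iFB.
  - move=> k; apply/measurable_EFinP; apply: measurable_funM => //.
    by have [sw _ _] := tw k; exact: smooth_measurable.
  - by apply/measurable_EFinP; exact: measurable_funM.
  - apply: aeW => z Dz; apply: cvg_EFin; first exact: nearW.
    by apply: cvgMr; exact: ww.
  - apply: aeW => z k Dz; rewrite lee_fin normrM (gtr0_norm (sol_F_gt0 sol Dz)).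
    by rewrite ler_wpM2l ?wB// ltW// (sol_F_gt0 sol Dz).
have cab := cvgeD _ ca cb.
have {}cab : (\int[mu]_(z in D) (F z * w_ k z)%:E @[k --> \oo] -->
   \int[mu]_(z in D) (a z * pflux p G G z)%:E +
   \int[mu]_(z in D) (b z * pflux p G (hgrad phi) z)%:E)%E.
  rewrite -(eq_cvg _ _ E); apply: cab.
  by rewrite fin_num_adde_defl// (integrable_fin_num mD ib').
by rewrite -(cvg_lim _ cab)// (cvg_lim _ cF).
Qed.

End test_by_nonsmooth_functions.

(** * Picone's inequality *)

Section picone_profiles.
Context {R : realType}.
Variable p : R.
Hypothesis p1 : 1 < p.
Implicit Types c d s t x y k M : R.

Let p0 : 0 < p. Proof. exact: lt_trans p1. Qed.

(* [phi_profile d t] is a smooth substitute for [|t|^p], and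
   [u_profile c s = theta^(1 - p)] one for [s^(1 - p)]; the constants make
   [theta = (u_profile_base c s)^(1/2)] satisfy [theta' >= 1] for [s >= 0]
   while [theta >= c^2] for all real [s]. *)
Definition phi_profile d t := (t * t + d) `^ (p / 2) + - (d `^ (p / 2)).

Definition phi_profile' d t := p / 2 * (t * t + d) `^ (p / 2 - 1) * (2 * t).

Definition u_profile_base c s := (1 + c * c) * ((s + c) * (s + c) + c ^+ 4).

Definition u_profile c s := u_profile_base c s `^ ((1 - p) / 2).

Definition u_profile' c s := (1 - p) / 2 * u_profile_base c s `^ ((1 - p) / 2 - 1)
  * ((1 + c * c) * (2 * (s + c))).

Lemma u_profile_base_ge c s : c ^+ 4 <= u_profile_base c s.
Proof.
have := sqr_ge0 c; have := sqr_ge0 (s + c); rewrite /u_profile_base !expr2 => h1 h2.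
have h4 : 0 <= c ^+ 4 by rewrite (exprM _ 2 2) sqr_ge0.
rewrite mulrDl mul1r -addrA ler_wpDl// lerDl mulr_ge0// addr_ge0//.
Qed.

Lemma u_profile_base_gt0 c s : 0 < c -> 0 < u_profile_base c s.
Proof. by move=> c0; apply: lt_le_trans (u_profile_base_ge c s); rewrite exprn_gt0. Qed.

Lemma ler0_powR (r a b : R) : r <= 0 -> 0 < a -> a <= b -> b `^ r <= a `^ r.
Proof.
move=> r0 a0 ab; rewrite -[r]opprK !(powRN _ (- r)) lef_pV2 ?posrE ?powR_gt0//.
  by apply: ge0_ler_powR; rewrite ?nnegrE ?oppr_ge0// ltW// (lt_le_trans a0).
exact: lt_le_trans ab.
Qed.

Lemma u_profile_gt0 c s : 0 < c -> 0 < u_profile c s.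
Proof. by move=> c0; rewrite powR_gt0// u_profile_base_gt0. Qed.

Lemma u_profile_le c s : 0 < c -> u_profile c s <= (c ^+ 4) `^ ((1 - p) / 2).
Proof.
move=> c0; apply: ler0_powR; last exact: u_profile_base_ge.
  by rewrite ler_pdivrMr// mul0r subr_le0 ltW.
by rewrite exprn_gt0.
Qed.

Lemma normr_le_half_powR (a b : R) : 0 <= b -> a * a <= b -> `|a| <= b `^ 2^-1.
Proof.
move=> b0 ab; by rewrite powR12_sqrt// -sqrtr_sqr ler_sqrt.
Qed.

(** The factor |s + c| is absorbed by half a power of the base, which leaves the negative exponent
    -p/2; the lower bound [c ^+ 4] of the base is then the worst case, for every real [s]. *)
Lemma normr_u_profile'_le c s : 0 < c ->
  `|u_profile' c s| <= (p - 1) * (1 + c * c) * (c ^+ 4) `^ (- (p / 2)).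
Proof.
move=> c0; have q0 := u_profile_base_gt0 s c0.
have e : `|s + c| <= u_profile_base c s `^ 2^-1.
  apply: normr_le_half_powR; first exact: ltW.
  have := sqr_ge0 c; have := sqr_ge0 (s + c); rewrite /u_profile_base !expr2 => h1 h2.
  have h4 : 0 <= c ^+ 4 by rewrite exprn_ge0// ltW.
  rewrite (@le_trans _ _ ((s + c) * (s + c) + c ^+ 4)) ?lerDl//.
  by rewrite ler_peMl ?lerDl// addr_ge0.
have cc : 0 < 1 + c * c by rewrite addr_gt0// mulr_gt0.
have pc : 0 <= (p - 1) * (1 + c * c).
  by apply: mulr_ge0; [rewrite subr_ge0|]; exact: ltW.
rewrite /u_profile' !normrM (ger0_norm (powR_ge0 _ _)) (gtr0_norm cc).
rewrite (_ : `|1 - p| = p - 1); last by rewrite ltr0_norm ?opprB// subr_lt0.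
rewrite (ger0_norm (ler0n R 2)) (_ : `|2^-1| = 2^-1); last by rewrite ger0_norm.
apply: (@le_trans _ _ ((p - 1) * (1 + c * c) * u_profile_base c s `^ (- (p / 2)))).
  have -> : u_profile_base c s `^ (- (p / 2)) =
      u_profile_base c s `^ ((1 - p) / 2 - 1) * u_profile_base c s `^ 2^-1.
    rewrite -powRD; last by rewrite (gt_eqF q0) implybT.
    by congr (_ `^ _); field.
  rewrite [leLHS](_ : _ = (p - 1) * (1 + c * c) *
    (u_profile_base c s `^ ((1 - p) / 2 - 1) * `|s + c|)); last by field.
  by rewrite ler_wpM2l// ler_pM2l// powR_gt0.
rewrite ler_wpM2l//.
apply: ler0_powR; last exact: u_profile_base_ge.
  by rewrite oppr_le0 divr_ge0// ltW.
by rewrite exprn_gt0.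
Qed.

Lemma phi_profile_ge0 d t : 0 < d -> 0 <= phi_profile d t.
Proof.
move=> d0; have t0 := sqr_ge0 t; rewrite expr2 in t0.
rewrite subr_ge0; apply: ge0_ler_powR; rewrite ?nnegrE ?lerDr//.
- by rewrite divr_ge0// ltW.
- exact: ltW.
- by rewrite addr_ge0// ltW.
Qed.

Lemma phi_profile_le d t M : 0 < d -> `|t| <= M ->
  phi_profile d t <= (M * M + d) `^ (p / 2).
Proof.
move=> d0 tM; rewrite /phi_profile; have t0 := sqr_ge0 t; rewrite expr2 in t0.
rewrite lerBlDr ler_wpDr ?powR_ge0//; apply: ge0_ler_powR; rewrite ?nnegrE.
- by rewrite divr_ge0// ltW.
- by rewrite addr_ge0// ltW.
- by have M0 := le_trans (normr_ge0 t) tM; rewrite addr_ge0 ?mulr_ge0// ltW.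
- by rewrite lerD2r -[t * t]ger0_norm// normrM ler_pM.
Qed.

(** Absorbing |t| in half a power of t^2 + d leaves the power p - 1 of its square root, the one that
    Young's inequality takes. *)
Lemma normr_phi_profile'_le d t : 0 < d ->
  `|phi_profile' d t| <= p * (t * t + d) `^ ((p - 1) / 2).
Proof.
move=> d0; have t0 := sqr_ge0 t; rewrite expr2 in t0.
have r0 : 0 < t * t + d by rewrite ltr_wpDl.
have e : `|t| <= (t * t + d) `^ 2^-1.
  by apply: normr_le_half_powR; [exact: ltW|rewrite lerDl ltW].
rewrite /phi_profile' !normrM (ger0_norm (powR_ge0 _ _)) (gtr0_norm p0).
rewrite (ger0_norm (ler0n R 2)) (_ : `|2^-1| = 2^-1); last by rewrite ger0_norm.
have -> : (t * t + d) `^ ((p - 1) / 2) =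
    (t * t + d) `^ (p / 2 - 1) * (t * t + d) `^ 2^-1.
  rewrite -powRD; last by rewrite (gt_eqF r0) implybT.
  by congr (_ `^ _); field.
rewrite [leLHS](_ : _ = p * ((t * t + d) `^ (p / 2 - 1) * `|t|)); last by field.
by rewrite ler_pM2l// ler_pM2l// powR_gt0.
Qed.

Lemma normr_phi_profile'_bound d t M : 0 < d -> `|t| <= M ->
  `|phi_profile' d t| <= p * (M * M + d) `^ ((p - 1) / 2).
Proof.
move=> d0 tM; apply: le_trans (normr_phi_profile'_le t d0) _.
have t0 := sqr_ge0 t; rewrite expr2 in t0.
rewrite ler_pM2l//; apply: ge0_ler_powR; rewrite ?nnegrE.
- by rewrite divr_ge0// subr_ge0 ltW.
- by rewrite addr_ge0// ltW.
- by have M0 := le_trans (normr_ge0 t) tM; rewrite addr_ge0 ?mulr_ge0// ltW.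
- by rewrite lerD2r -[t * t]ger0_norm// normrM ler_pM.
Qed.

(* This is [theta' >= 1]. *)
Lemma u_profile'_le c s : 0 < c -> 0 <= s ->
  u_profile' c s <= - ((p - 1) * u_profile_base c s `^ (- (p / 2))).
Proof.
move=> c0 s0; have q0 := u_profile_base_gt0 s c0.
have e : u_profile_base c s `^ 2^-1 <= (1 + c * c) * (s + c).
  have cs : 0 <= s + c by rewrite addr_ge0// ltW.
  have cc : 0 <= c * c by rewrite mulr_ge0// ltW.
  have h : 0 <= (1 + c * c) * (s + c) by rewrite mulr_ge0// addr_ge0.
  rewrite (powR12_sqrt (ltW q0)) -[leRHS](ger0_norm h) -sqrtr_sqr.
  apply: ler_wsqrtr.
  (* After squaring and dividing by [1 + c * c], the claim is c^2 (s + c)^2 >= c^4. The shift by [c]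
     makes it true, and [s >= 0] is used here. *)
  rewrite /u_profile_base exprMn -subr_ge0 !expr2.
  rewrite (_ : _ - _ = (1 + c * c) * ((c * c) * (s * s + 2 * s * c))); last by ring.
  by rewrite !mulr_ge0// ?addr_ge0 ?mulr_ge0// ltW.
have -> : u_profile_base c s `^ (- (p / 2)) =
    u_profile_base c s `^ ((1 - p) / 2 - 1) * u_profile_base c s `^ 2^-1.
  rewrite -powRD; last by rewrite (gt_eqF q0) implybT.
  by congr (_ `^ _); field.
rewrite (_ : u_profile' c s = - ((p - 1) * (u_profile_base c s `^ ((1 - p) / 2 - 1) *
  ((1 + c * c) * (s + c))))); last by rewrite /u_profile'; field.
by rewrite lerN2 ler_pM2l ?subr_gt0// ler_pM2l// powR_gt0.
Qed.

(* Picone's inequality for the test function [phi_profile phi * u_profile u],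
   with [x = |grad phi|], [y = |grad u|] and
   [k = |grad u|^(p - 2) grad u . grad phi]. *)
Lemma picone_pointwise c s t x y k : 0 < c -> 0 <= s -> 0 <= x -> 0 <= y ->
  `|k| <= y `^ (p - 1) * x ->
  phi_profile (c ^+ 6) t * u_profile' c s * y `^ p +
    phi_profile' (c ^+ 6) t * u_profile c s * k <=
  x `^ p + (p - 1) * c `^ p * y `^ p.
Proof.
move=> c0 s0 x0 y0 ky; set d := c ^+ 6.
have d0 : 0 < d by rewrite exprn_gt0.
have q0 := u_profile_base_gt0 s c0; set q := u_profile_base c s in q0 *.
have t0 := sqr_ge0 t; rewrite expr2 in t0.
have r0 : 0 < t * t + d by rewrite ltr_wpDl.
have pB1 : 0 < p - 1 by rewrite subr_gt0.
(* The regularized form of |phi| |grad u| / u, to be paired with [x] in Young's inequality. *)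
pose A := (t * t + d) `^ 2^-1 * (y * q `^ (- 2^-1)).
have A0 : 0 <= A by rewrite !mulr_ge0 ?powR_ge0.
have AE r : A `^ r = (t * t + d) `^ (r / 2) * (y `^ r * q `^ (- (r / 2))).
  rewrite /A powRM ?mulr_ge0 ?powR_ge0// powRM ?powR_ge0// -!powRrM.
  by rewrite mulNr ![2^-1 * r]mulrC.
have young := young_powR p1 A0 x0.
have h1 : phi_profile' d t * u_profile c s * k <= p * (A `^ (p - 1) * x).
  apply: le_trans (ler_norm _) _.
  rewrite 2!normrM (gtr0_norm (u_profile_gt0 s c0)) AE.
  apply: (@le_trans _ _ (p * (t * t + d) `^ ((p - 1) / 2) * u_profile c s *
      (y `^ (p - 1) * x))).
    apply: ler_pM => //; first by rewrite mulr_ge0// ltW// u_profile_gt0.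
    by rewrite ler_pM2r ?u_profile_gt0// normr_phi_profile'_le.
  rewrite /u_profile -/q (_ : (1 - p) / 2 = - ((p - 1) / 2)); last by field.
  by rewrite le_eqVlt; apply/orP; left; apply/eqP; ring.
have h2 : phi_profile d t * u_profile' c s * y `^ p <=
    - ((p - 1) * (phi_profile d t * (q `^ (- (p / 2)) * y `^ p))).
  rewrite [leRHS](_ : _ = phi_profile d t * (- ((p - 1) * q `^ (- (p / 2)))) * y `^ p);
    last by ring.
  rewrite ler_wpM2r ?powR_ge0// ler_wpM2l ?phi_profile_ge0//.
  exact: u_profile'_le.
(* Young's term (p - 1) A^p is cancelled by [h2] except for the constant d^(p/2) subtracted in
   [phi_profile]. The exponent 6 is chosen for this remainder: c^6 = c^2 c^4 <= c^2 q. *)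
have h3 : d `^ (p / 2) * q `^ (- (p / 2)) <= c `^ p.
  rewrite powRN ler_pdivrMr ?powR_gt0//.
  have -> : c `^ p = (c ^+ 2) `^ (p / 2).
    by rewrite -powR_mulrn ?ltW// -powRrM mulrC divfK.
  rewrite -powRM ?sqr_ge0 ?(ltW q0)//; apply: ge0_ler_powR; rewrite ?nnegrE.
  - by rewrite divr_ge0// ltW.
  - exact: ltW.
  - by rewrite mulr_ge0// ?sqr_ge0// ltW.
  - rewrite /d (_ : 6 = 2 + 4)%N// exprD ler_wpM2l ?sqr_ge0//.
    exact: u_profile_base_ge.
apply: le_trans (lerD h2 (le_trans h1 young)) _.
rewrite AE {1}/phi_profile.
set P := (t * t + d) `^ (p / 2); set Q := q `^ _; set Y := y `^ p; set Dd := d `^ _.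
rewrite [leLHS](_ : _ = x `^ p + (p - 1) * (Dd * Q) * Y); last by ring.
by rewrite lerD2l ler_wpM2r ?powR_ge0// ler_wpM2l// ltW.
Qed.

End picone_profiles.

(** * Picone's inequality between a solution and a test function *)

Section picone_inequality.
Context {R : realType} {n : nat}.
Local Notation H := (heisenberg R n).
Local Notation mu := (@heisenberg_measure R n).
Variables (p : R) (Omega D : set H).
Hypotheses (p1 : 1 < p) (mD : measurable D).
Local Notation energy := (energy_norm mu D p).

Let p0 : 0 < p. Proof. exact: lt_trans p1. Qed.

Lemma smooth_sqrD (phi : H -> R) (d : R) : smooth phi ->
  smooth (fun z => phi z * phi z + d).
Proof. by move=> sphi; apply: smoothD; [exact: smoothM|exact: smooth_cst]. Qed.

Lemma partial_sqrD (phi : H -> R) (d : R) j z : smooth phi ->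
  partial j (fun z => phi z * phi z + d) z = 2 * phi z * partial j phi z.
Proof.
move=> sphi; have s2 : smooth (fun z => phi z * phi z) by exact: smoothM.
have sd : smooth ((fun=> d) : H -> R) by exact: smooth_cst.
rewrite (partialD j z s2 sd) (partialM j z sphi sphi) partial_cst.
by ring.
Qed.

Lemma sqrD_gt0 (x d : R) : 0 < d -> 0 < x * x + d.
Proof. by move=> d0; rewrite ltr_wpDl// -expr2 sqr_ge0. Qed.

Lemma smooth_phi_profile (phi : H -> R) (d : R) : 0 < d -> smooth phi ->
  smooth (fun z => phi_profile p d (phi z)).
Proof.
move=> d0 sphi; apply: smoothD; last exact: smooth_cst.
by apply: smooth_powR => [z|]; [exact: sqrD_gt0|exact: smooth_sqrD].
Qed.

Lemma partial_phi_profile (phi : H -> R) (d : R) j z : 0 < d -> smooth phi ->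
  partial j (fun z => phi_profile p d (phi z)) z =
  phi_profile' p d (phi z) * partial j phi z.
Proof.
move=> d0 sphi; have s2 := smooth_sqrD d sphi.
have gt z' : 0 < phi z' * phi z' + d by exact: sqrD_gt0.
have sp : smooth (fun z => (phi z * phi z + d) `^ (p / 2)) by exact: smooth_powR.
have sd : smooth ((fun=> - (d `^ (p / 2))) : H -> R) by exact: smooth_cst.
rewrite /phi_profile (partialD j z sp sd) partial_cst addr0.
by rewrite (partial_powR _ j z gt s2) partial_sqrD// /phi_profile' !mulrA.
Qed.

Lemma smooth_u_profile_base (psi : H -> R) (c : R) : smooth psi ->
  smooth (fun z => u_profile_base c (psi z)).
Proof.
move=> spsi; apply: smoothM; first exact: smooth_cst.
have sc : smooth (fun z => psi z + c) := smoothD spsi (smooth_cst c).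
exact: smooth_sqrD.
Qed.

Lemma partial_u_profile_base (psi : H -> R) (c : R) j z : smooth psi ->
  partial j (fun z => u_profile_base c (psi z)) z =
  (1 + c * c) * (2 * (psi z + c)) * partial j psi z.
Proof.
move=> spsi; have sc' : smooth ((fun=> c) : H -> R) by exact: smooth_cst.
have sc : smooth (fun z => psi z + c) by apply: smoothD.
have s2 := smooth_sqrD (c ^+ 4) sc.
have s1 : smooth ((fun=> 1 + c * c) : H -> R) by exact: smooth_cst.
rewrite /u_profile_base (partialM j z s1 s2) partial_cst mulr0 addr0.
by rewrite (partial_sqrD _ j z sc) (partialD j z spsi sc') partial_cst addr0 !mulrA.
Qed.

Lemma smooth_u_profile (psi : H -> R) (c : R) : 0 < c -> smooth psi ->
  smooth (fun z => u_profile p c (psi z)).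
Proof.
move=> c0 spsi; apply: smooth_powR => [z|]; first exact: u_profile_base_gt0.
exact: smooth_u_profile_base.
Qed.

Lemma partial_u_profile (psi : H -> R) (c : R) j z : 0 < c -> smooth psi ->
  partial j (fun z => u_profile p c (psi z)) z =
  u_profile' p c (psi z) * partial j psi z.
Proof.
move=> c0 spsi; have sb := smooth_u_profile_base c spsi.
have gt z' : 0 < u_profile_base c (psi z') by exact: u_profile_base_gt0.
rewrite /u_profile (partial_powR _ j z gt sb) partial_u_profile_base//.
by rewrite /u_profile' !mulrA.
Qed.

Lemma cvg_u_profile_base (c s : R) (x : nat -> R) : x @ \oo --> s ->
  (fun k => u_profile_base c (x k)) @ \oo --> u_profile_base c s.
Proof.
move=> xs; apply: cvgMr; apply: cvgD; last exact: cvg_cst.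
by apply: cvgM; apply: cvgD => //; exact: cvg_cst.
Qed.

Lemma cvg_u_profile (c s : R) (x : nat -> R) : 0 < c -> x @ \oo --> s ->
  (fun k => u_profile p c (x k)) @ \oo --> u_profile p c s.
Proof.
move=> c0 xs; apply: cvg_powR; first exact: u_profile_base_gt0.
exact: cvg_u_profile_base.
Qed.

Lemma cvg_u_profile' (c s : R) (x : nat -> R) : 0 < c -> x @ \oo --> s ->
  (fun k => u_profile' p c (x k)) @ \oo --> u_profile' p c s.
Proof.
move=> c0 xs; apply: cvgM; last first.
  by apply: cvgMr; apply: cvgMr; apply: cvgD => //; exact: cvg_cst.
apply: cvgMr; apply: cvg_powR; first exact: u_profile_base_gt0.
exact: cvg_u_profile_base.
Qed.

Lemma measurable_u_profile' (psi : H -> R) (c : R) : smooth psi ->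
  measurable_fun D (fun z => u_profile' p c (psi z)).
Proof.
move=> spsi; have mpsi := @smooth_measurable _ _ D _ spsi.
have mb := @smooth_measurable _ _ D _ (smooth_u_profile_base c spsi).
apply: measurable_funM.
  apply: measurable_funM; first exact: measurable_cst.
  exact: measurable_fun_powR.
apply: measurable_funM; first exact: measurable_cst.
apply: measurable_funM; first exact: measurable_cst.
by apply: measurable_funD => //; exact: measurable_cst.
Qed.

Lemma measurable_phi_profile' (phi : H -> R) (d : R) : smooth phi ->
  measurable_fun D (fun z => phi_profile' p d (phi z)).
Proof.
move=> sphi; have mphi := @smooth_measurable _ _ D _ sphi.
have mb := @smooth_measurable _ _ D _ (smooth_sqrD d sphi).
apply: measurable_funM.
  apply: measurable_funM; first exact: measurable_cst.
  exact: measurable_fun_powR.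
by apply: measurable_funM => //; exact: measurable_cst.
Qed.

(** This is why d^(p/2) is subtracted in [phi_profile]: products with the profile keep the support
    of [phi]. *)
Lemma phi_profile0 (d : R) : phi_profile p d 0 = 0.
Proof. by rewrite /phi_profile mul0r add0r subrr. Qed.

(** [test_limit] first replaces [psi k] by [u] in an equality; [picone_pointwise] then applies to
    the integrand, because [u] is positive on [D] whereas [psi k] may take negative values. *)
Lemma picone_test_function F u G psi (phi : H -> R) (c : R) :
  solution_on p Omega D F u G psi -> test_function Omega phi ->
  (energy (hgrad phi) < +oo)%E -> 0 < c ->
  (\int[mu]_(z in D) (F z * (phi_profile p (c ^+ 6) (phi z) * u_profile p c (u z)))%:E <=
   \int[mu]_(z in D) (enorm (hgrad phi z) `^ p)%:E +
   ((p - 1) * c `^ p)%:E * \int[mu]_(z in D) (enorm (G z) `^ p)%:E)%E.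
Proof.
move=> sol tphi phioo c0; set d := c ^+ 6.
have d0 : 0 < d by rewrite exprn_gt0.
have [sphi _ _] := tphi; have [M M0 phiM] := test_function_bounded tphi.
have mG := sol_mG sol; have Goo := sol_Goo sol.
have spsi k : smooth (psi k) by have [] := sol_test sol k.
(* [K] and [K'] bound the profile of [psi k] and its derivative on the whole line, [W] and [W']
   those of [phi] on [-M, M]; [C] bounds all the coefficients at once. *)
pose K := (c ^+ 4) `^ ((1 - p) / 2).
pose K' := (p - 1) * (1 + c * c) * (c ^+ 4) `^ (- (p / 2)).
pose W := (M * M + d) `^ (p / 2).
pose W' := p * (M * M + d) `^ ((p - 1) / 2).
pose C := W * K' + W' * K.
have K0 : 0 <= K by exact: powR_ge0.
have K'0 : 0 <= K'.
  apply: mulr_ge0; last exact: powR_ge0.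
  by rewrite mulr_ge0 ?subr_ge0 ?(ltW p1)// addr_ge0// mulr_ge0// ltW.
have W0 : 0 <= W by exact: powR_ge0.
have W'0 : 0 <= W' by rewrite mulr_ge0 ?powR_ge0// ltW.
have C0 : 0 <= C by apply: addr_ge0; apply: mulr_ge0.
pose a_ k z := phi_profile p d (phi z) * u_profile' p c (psi k z).
pose b_ k z := phi_profile' p d (phi z) * u_profile p c (psi k z).
pose a z := phi_profile p d (phi z) * u_profile' p c (u z).
pose b z := phi_profile' p d (phi z) * u_profile p c (u z).
pose w_ k z := phi_profile p d (phi z) * u_profile p c (psi k z).
pose w z := phi_profile p d (phi z) * u_profile p c (u z).
pose B z := K * phi_profile p d (phi z).
pose beta z := K * phi_profile' p d (phi z).
have sw1 := smooth_phi_profile d0 sphi.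
have su k := smooth_u_profile c0 (spsi k).
have aC t s : `|t| <= M -> `|phi_profile p d t * u_profile' p c s| <= W * K'.
  move=> tM; rewrite normrM ger0_norm ?phi_profile_ge0//.
  by rewrite ler_pM ?phi_profile_ge0 ?phi_profile_le ?normr_u_profile'_le.
have bC t s : `|t| <= M -> `|phi_profile' p d t * u_profile p c s| <= W' * K.
  move=> tM; rewrite normrM (gtr0_norm (u_profile_gt0 p s c0)).
  rewrite ler_pM ?normr_phi_profile'_bound ?u_profile_le//.
  by rewrite ltW// u_profile_gt0.
have leC1 : W * K' <= C by rewrite lerDl mulr_ge0.
have leC2 : W' * K <= C by rewrite lerDr mulr_ge0.
have mw1 := @smooth_measurable _ _ D _ sw1.
have mphi' := measurable_phi_profile' d sphi.
have key : (\int[mu]_(z in D) (a z * pflux p G G z)%:E +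
    \int[mu]_(z in D) (b z * pflux p G (hgrad phi) z)%:E =
    \int[mu]_(z in D) (F z * w z)%:E)%E.
  apply: (@test_limit R n p Omega D p1 mD F u G psi phi w_ w a_ b_ a b B beta C
    sol tphi phioo C0).
  - move=> k; apply: (test_function_sub tphi (smoothM sw1 (su k))).
    by move=> z phi0; rewrite /w_ phi0 phi_profile0 mul0r.
  - move=> k z; apply: hgrad_lin => j.
    rewrite /w_ (partialM j z sw1 (su k)).
    rewrite (partial_u_profile j z c0 (spsi k)) (partial_phi_profile j z d0 sphi).
    by rewrite /a_ /b_; ring.
  - by move=> k; exact: (measurable_funM mw1 (measurable_u_profile' c (spsi k))).
  - by move=> k; exact: (measurable_funM mphi' (smooth_measurable (su k))).
  - by move=> k z Dz; apply: le_trans leC1; exact: aC.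
  - by move=> k z Dz; apply: le_trans leC2; exact: bC.
  - by move=> z Dz; apply: cvgMr; apply: cvg_u_profile' => //; exact: (sol_cvg sol).
  - by move=> z Dz; apply: cvgMr; apply: cvg_u_profile => //; exact: (sol_cvg sol).
  - by move=> z Dz; apply: cvgMr; apply: cvg_u_profile => //; exact: (sol_cvg sol).
  - apply: (test_function_sub tphi (smoothM (smooth_cst K) sw1)).
    by move=> z phi0; rewrite /B phi0 phi_profile0 mulr0.
  - move=> z; rewrite (@hgrad_lin _ _ phi phi B 0 (beta z)).
      by rewrite scale0r add0r.
    move=> j.
    have sK : smooth ((fun=> K) : H -> R) by exact: smooth_cst.
    rewrite /B (partialM j z sK sw1) partial_cst (partial_phi_profile j z d0 sphi) /beta.
    by ring.
  - by apply: measurable_funM => //; exact: measurable_cst.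
  - move=> z Dz; apply: le_trans leC2.
    by rewrite /beta normrM (ger0_norm K0) mulrC ler_pM// normr_phi_profile'_bound.
  - move=> k z Dz; rewrite /w_ normrM (gtr0_norm (u_profile_gt0 p _ c0)).
    rewrite ger0_norm ?phi_profile_ge0// mulrC.
    by rewrite ler_wpM2r ?phi_profile_ge0 ?u_profile_le.
rewrite -key.
have mu_ := sol_mu sol.
have mb' : measurable_fun D b.
  apply: measurable_funM => //.
  apply: (@measurable_fun_cvg _ _ _ _ (fun k z => u_profile p c (psi k z))) => [k|z Dz].
    exact: (smooth_measurable (su k)).
  by apply: cvg_u_profile => //; exact: (sol_cvg sol).
have ma' : measurable_fun D a.
  apply: measurable_funM => //.
  apply: (@measurable_fun_cvg _ _ _ _ (fun k z => u_profile' p c (psi k z))) => [k|z Dz].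
    exact: (measurable_u_profile' c (spsi k)).
  by apply: cvg_u_profile' => //; exact: (sol_cvg sol).
have mphi := vmeasurable_hgrad (D := D) sphi.
have ia : mu.-integrable D (EFin \o (fun z => a z * pflux p G G z)).
  apply: (pflux_integrable mD p1 mG Goo ma' mG C0 _ Goo) => z Dz.
  by apply: le_trans leC1; exact: aC.
have ib : mu.-integrable D (EFin \o (fun z => b z * pflux p G (hgrad phi) z)).
  apply: (pflux_integrable mD p1 mG Goo mb' mphi C0 _ phioo) => z Dz.
  by apply: le_trans leC2; exact: bC.
have menr X : vmeasurable D X -> measurable_fun D (fun z => (enorm (X z) `^ p)%:E).
  move=> mX; apply/measurable_EFinP; apply: measurable_fun_powR.
  exact: measurable_enorm.
have ien X : vmeasurable D X -> (energy X < +oo)%E ->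
    mu.-integrable D (EFin \o (fun z => enorm (X z) `^ p)).
  move=> mX Xoo; apply/integrableP; split; first exact: menr.
  under eq_integral do rewrite gee0_abs ?lee_fin ?powR_ge0//.
  by rewrite -energyE// poweR_lty.
rewrite -(integralD_EFin mD ia ib).
have cp0 : 0 <= (p - 1) * c `^ p by rewrite mulr_ge0 ?powR_ge0 ?subr_ge0 ?(ltW p1).
have iG := ien _ _ mG Goo.
have icG : mu.-integrable D (EFin \o (fun z => (p - 1) * c `^ p * enorm (G z) `^ p)).
  by have := integrableZl mD ((p - 1) * c `^ p) iG.
have iphi := ien _ _ mphi phioo.
have -> : (((p - 1) * c `^ p)%:E * \int[mu]_(z in D) (enorm (G z) `^ p)%:E =
    \int[mu]_(z in D) ((p - 1) * c `^ p * enorm (G z) `^ p)%:E)%E.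
  by rewrite -(integralZl mD iG).
rewrite -(integralD_EFin mD iphi icG); apply: le_integral => //.
- by have := integrableD mD ia ib.
- by have := integrableD mD iphi icG.
move=> z /set_mem Dz; rewrite /= lee_fin pflux_self//.
apply: picone_pointwise => //.
- by rewrite ltW// (sol_u_gt0 sol).
- exact: enorm_ge0.
- exact: enorm_ge0.
- exact: normr_pflux_le.
Qed.

End picone_inequality.

Lemma fatou_cvg d (T : measurableType d) (R : realType)
    (mu : {measure set T -> \bar R}) (D : set T) (f_ : nat -> T -> R) (f : T -> R)
    (b : nat -> \bar R) (l : \bar R) : measurable D ->
  (forall k, measurable_fun D (f_ k)) -> (forall k z, D z -> 0 <= f_ k z) ->
  (forall z, D z -> f_ ^~ z @ \oo --> f z) ->
  (forall k, \int[mu]_(z in D) (f_ k z)%:E <= b k)%E -> b @ \oo --> l ->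
  (\int[mu]_(z in D) (f z)%:E <= l)%E.
Proof.
move=> mD mf f0 ff fb bl.
have := @fatou _ _ _ mu D mD (fun k z => (f_ k z)%:E).
move=> /(_ (fun k => (measurable_EFinP _ _).2 (mf k))) /(_ _)/wrap[k z Dz|].
  by rewrite lee_fin f0.
rewrite (_ : (\int[mu]_(x in D) limn_einf _ = \int[mu]_(z in D) (f z)%:E)%E); last first.
  apply: eq_integral => z /set_mem Dz; apply: (cvg_limn_einf_sup _).1.
  by apply: cvg_EFin; [exact: nearW|exact: ff].
move=> /le_trans; apply; rewrite limn_einf_lim.
apply: (lee_cvg_to (is_cvg_einfs (u := _)) bl); apply: nearW => k.
apply: le_trans (fb k); apply: ereal_inf_lbound; by exists k => /=.
Qed.

(** * Picone's inequality between two solutions *)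

Section energy_inequalities.
Context {R : realType} {n : nat}.
Local Notation H := (heisenberg R n).
Local Notation mu := (@heisenberg_measure R n).
Variables (p : R) (Omega D : set H).
Hypotheses (p1 : 1 < p) (mD : measurable D).
Local Notation energy := (energy_norm mu D p).

Let p0 : 0 < p. Proof. exact: lt_trans p1. Qed.

Lemma energy_integral_lty (G : H -> 'rV[R]_(n + n)) : (energy G < +oo)%E ->
  (\int[mu]_(z in D) (enorm (G z) `^ p)%:E)%E \is a fin_num.
Proof.
move=> Goo; rewrite ge0_fin_numE; first by rewrite -energyE// poweR_lty.
by apply: integral_ge0 => z _; rewrite lee_fin powR_ge0.
Qed.

Lemma cvg_inv_natS : (fun k => k.+1%:R^-1 : R) @ \oo --> 0.
Proof. exact: cvg_harmonic. Qed.

Lemma inv_natS_gt0 k : 0 < k.+1%:R^-1 :> R.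
Proof. by rewrite invr_gt0. Qed.

Lemma powR_sqr (s r : R) : 0 <= s -> (s * s) `^ (r / 2) = s `^ r.
Proof.
by move=> s0; rewrite -expr2 -powR_mulrn// -powRrM mulrC divfK.
Qed.

Lemma cvg_phi_profile (x c : nat -> R) (t : R) : 0 < t -> (forall k, 0 < c k) ->
  x @ \oo --> t -> c @ \oo --> 0 ->
  (fun k => phi_profile p (c k ^+ 6) (x k)) @ \oo --> t `^ p.
Proof.
move=> t0 c0 xt cc.
have c3 : (fun k => c k * c k * c k) @ \oo --> (0 : R).
  by rewrite -[X in _ --> X](mulr0 (0 * 0 : R)); apply: cvgM => //; exact: cvgM.
(* As c^6 is the square of c^3, the constant d^(p/2) is (c^3)^p. Its exponent is at least 1, which
   p/2 need not be, so [cvg_powR_ge1] applies at the limit 0. *)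
have cE k : c k ^+ 6 = (c k * c k * c k) * (c k * c k * c k) by ring.
rewrite -[X in _ --> X]addr0; apply: cvgD.
  rewrite -(powR_sqr p (ltW t0)); apply: cvg_powR; first exact: mulr_gt0.
  rewrite -[X in _ --> X]addr0; apply: cvgD; first exact: cvgM.
  rewrite -[X in _ --> X](mulr0 (0 : R)); under eq_fun do rewrite cE.
  exact: cvgM.
rewrite -oppr0; apply: cvgN; rewrite -(powR0 (lt0r_neq0 p0)).
under eq_fun do rewrite cE powR_sqr ?mulr_ge0 ?(ltW (c0 _))//.
apply: cvg_powR_ge1 => //; first exact: ltW.
by move=> k; rewrite !mulr_ge0// ltW.
Qed.

Lemma cvg_u_profile_param (c : nat -> R) (s : R) : 0 < s ->
  c @ \oo --> 0 -> (fun k => u_profile p (c k) s) @ \oo --> s `^ (1 - p).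
Proof.
move=> s0 cc; rewrite -(powR_sqr (1 - p) (ltW s0)); apply: cvg_powR.
  exact: mulr_gt0.
have c2 : (fun k => c k * c k) @ \oo --> (0 : R).
  by rewrite -[X in _ --> X](mulr0 (0 : R)); exact: cvgM.
have c4 : (fun k => c k ^+ 4) @ \oo --> (0 : R).
  rewrite (_ : (fun k => _) = (fun k => (c k * c k) * (c k * c k))).
    by rewrite -[X in _ --> X](mulr0 (0 : R)); exact: cvgM.
  by apply/funext => k; ring.
have sc : (fun k => s + c k) @ \oo --> s.
  by rewrite -[X in _ --> X]addr0; apply: cvgD => //; exact: cvg_cst.
rewrite -[X in _ --> X]mul1r; apply: cvgM.
  by rewrite -[X in _ --> X]addr0; apply: cvgD => //; exact: cvg_cst.
by rewrite -[X in _ --> X]addr0; apply: cvgD => //; exact: cvgM.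
Qed.

(** The parameter 1/(k+1) and the test function [phi k] pass to the limit together. The left
    integrands are nonnegative, so Fatou's lemma applies; on the right the energies converge and the
    error, a multiple of c_k^p times the energy of [u], vanishes. *)
Lemma picone_integral F u G psi F' v G' phi :
  solution_on p Omega D F u G psi -> solution_on p Omega D F' v G' phi ->
  (\int[mu]_(z in D) (F z * (v z `^ p * u z `^ (1 - p)))%:E <=
   \int[mu]_(z in D) (enorm (G' z) `^ p)%:E)%E.
Proof.
move=> solu solv; pose c k : R := k.+1%:R^-1.
have c0 k : 0 < c k by exact: inv_natS_gt0.
have sphi k : smooth (phi k) by have [] := sol_test solv k.
have EG := energy_integral_lty (sol_Goo solu).
apply: (@fatou_cvg _ _ _ mu D (fun k z =>
    F z * (phi_profile p (c k ^+ 6) (phi k z) * u_profile p (c k) (u z))) _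
  (fun k => \int[mu]_(z in D) (enorm (hgrad (phi k) z) `^ p)%:E +
    ((p - 1) * c k `^ p)%:E * \int[mu]_(z in D) (enorm (G z) `^ p)%:E)%E) => //.
- move=> k; apply: (measurable_funM (sol_mF solu)); apply: measurable_funM.
    by apply: smooth_measurable; apply: smooth_phi_profile (sphi k); rewrite exprn_gt0.
  apply: measurable_fun_powR; apply: measurable_funM; first exact: measurable_cst.
  have mc : measurable_fun D (fun z => u z + c k).
    by apply: measurable_funD (sol_mu solu) _; exact: measurable_cst.
  by apply: measurable_funD; [exact: measurable_funM|exact: measurable_cst].
- move=> k z Dz; rewrite !mulr_ge0 ?powR_ge0//; first by rewrite ltW// (sol_F_gt0 solu).
  by rewrite phi_profile_ge0// exprn_gt0.
- move=> z Dz; apply: cvgMr; apply: cvgM.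
    apply: cvg_phi_profile => //; [exact: (sol_u_gt0 solv)|exact: (sol_cvg solv)|].
    exact: cvg_inv_natS.
  by apply: cvg_u_profile_param; [exact: (sol_u_gt0 solu)|exact: cvg_inv_natS].
- move=> k; apply: (picone_test_function p1 mD solu (sol_test solv k)) => //.
  exact: (sol_psioo solv).
rewrite -[X in _ --> X]adde0; apply: cvgeD.
- by rewrite fin_num_adde_defl.
- apply: cvg_energy => //; [exact: (fun k => sol_mpsi k solv)|exact: (sol_mG solv)|
    exact: (sol_Goo solv)|exact: (sol_psioo solv)|exact: (sol_cvgG solv)].
rewrite -[X in _ --> X](mul0e (\int[mu]_(z in D) (enorm (G z) `^ p)%:E)%E).
apply: cvgeZr => //; apply: cvg_EFin; first exact: nearW.
rewrite -[X in _ --> X](mulr0 (p - 1)); apply: cvgMr.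
rewrite -(powR0 (lt0r_neq0 p0)); apply: cvg_powR_ge1; first exact: ltW.
  by move=> k; rewrite ltW.
exact: cvg_inv_natS.
Qed.

End energy_inequalities.

(** * The energy identity *)

Section mean_profile.
Context {R : realType}.
Implicit Types c s t : R.

(* For [c = 0] this is the function [2 s t^2 / (s^2 + t^2)], which is homogeneous
   of degree 1, bounded by [2 s] and equal to [s] for [s = t]. *)
Definition mean_den c s t := s * s + (t * t + c * c).
Definition mean_profile c s t := 2 * s * (t * t) * (mean_den c s t)^-1.
Definition mean_profile_ds c s t := 2 * (t * t) * (mean_den c s t)^-1
  - 4 * (s * s) * (t * t) * ((mean_den c s t)^-1 * (mean_den c s t)^-1).
Definition mean_profile_dt c s t := 4 * (s * t) * (mean_den c s t)^-1
  - 4 * (s * t) * (t * t) * ((mean_den c s t)^-1 * (mean_den c s t)^-1).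

Lemma mean_den_gt0 c s t : 0 < c -> 0 < mean_den c s t.
Proof.
move=> c0; have := sqr_ge0 s; have := sqr_ge0 t; rewrite !expr2 => h1 h2.
by rewrite ltr_wpDl// ltr_wpDl// mulr_gt0.
Qed.

(** The derivatives of the profile are polynomials in these ratios, so they are bounded
    independently of [c]. The mixed ratio comes from the squares of s - t and s + t. *)
Lemma mean_ratios c s t : 0 < c ->
  [/\ 0 <= s * s * (mean_den c s t)^-1 <= 1, 0 <= t * t * (mean_den c s t)^-1 <= 1
    & `|s * t * (mean_den c s t)^-1| <= 1].
Proof.
move=> c0; have d0 := mean_den_gt0 s t c0.
have := sqr_ge0 s; have := sqr_ge0 t; have := sqr_ge0 c.
have := sqr_ge0 (s - t); have := sqr_ge0 (s + t).
rewrite !expr2 /mean_den in d0 * => h1 h2 h3 h4 h5.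
split.
- by rewrite divr_ge0 ?(ltW d0)//= ler_pdivrMr// mul1r lerDl addr_ge0.
- rewrite divr_ge0 ?(ltW d0)//= ler_pdivrMr// mul1r addrCA lerDl addr_ge0//.
- rewrite ler_norml ler_pdivlMr// ler_pdivrMr//; apply/andP; split; nra.
Qed.

Lemma normr_mean_profile_ds_le c s t : 0 < c -> `|mean_profile_ds c s t| <= 6.
Proof.
move=> c0; have [/andP[a0 a1] /andP[b0 b1] _] := mean_ratios s t c0.
set I := (mean_den c s t)^-1 in a0 a1 b0 b1.
rewrite (_ : mean_profile_ds c s t = 2 * (t * t * I) - 4 * ((s * s * I) * (t * t * I)));
  last by rewrite /mean_profile_ds -/I; ring.
have m0 : 0 <= (s * s * I) * (t * t * I) by rewrite mulr_ge0.
have m1 : (s * s * I) * (t * t * I) <= 1 by rewrite mulr_ile1.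
rewrite ler_norml; apply/andP; split; lra.
Qed.

Lemma normr_mean_profile_dt_le c s t : 0 < c -> `|mean_profile_dt c s t| <= 8.
Proof.
move=> c0; have [_ /andP[b0 b1] z1] := mean_ratios s t c0.
set I := (mean_den c s t)^-1 in b0 b1 z1.
rewrite (_ : mean_profile_dt c s t = 4 * (s * t * I) - 4 * ((s * t * I) * (t * t * I)));
  last by rewrite /mean_profile_dt -/I; ring.
have m1 : `|(s * t * I) * (t * t * I)| <= 1.
  by rewrite normrM mulr_ile1// ger0_norm.
move: z1 m1; rewrite !ler_norml => /andP[z1 z2] /andP[m1 m2].
apply/andP; split; lra.
Qed.

(** From 2 |s| c <= s^2 + c^2. The bound degenerates as c tends to 0 but is free of [s]: for fixed
    [c] it provides a test function as majorant. *)
Lemma normr_mean_profile_le c s t : 0 < c ->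
  `|mean_profile c s t| <= c^-1 * (t * t).
Proof.
move=> c0; have d0 := mean_den_gt0 s t c0.
have t0 := sqr_ge0 t; rewrite expr2 in t0.
rewrite /mean_profile mulrAC normrM (ger0_norm t0) ler_wpM2r//.
have cc : 0 < c * c by exact: mulr_gt0.
have h1 := sqr_ge0 (s - c); have h2 := sqr_ge0 (s + c).
rewrite !expr2 in h1 h2; rewrite /mean_den in d0 *.
have e : c^-1 = (s * s + (t * t + c * c)) * c^-1 * (s * s + (t * t + c * c))^-1.
  by rewrite mulrAC divff ?mul1r// gt_eqF.
rewrite ler_norml [X in - X]e [X in _ && (_ <= X)]e -mulNr.
rewrite !ler_pM2r ?invr_gt0// -mulNr ler_pdivrMr// ler_pdivlMr//.
apply/andP; split; nra.
Qed.

(** In contrast to the bound by c^-1 t^2, this one is free of [c] and [t], so it still dominates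
    when c tends to 0. *)
Lemma mean_profile_bounds c s t : 0 < c -> 0 <= s ->
  0 <= mean_profile c s t <= 2 * s.
Proof.
move=> c0 s0; have [_ /andP[b0 b1] _] := mean_ratios s t c0.
rewrite /mean_profile -mulrA; apply/andP; split.
  by apply: mulr_ge0 => //; exact: mulr_ge0.
by rewrite -[leRHS]mulr1 ler_wpM2l// mulr_ge0.
Qed.

Lemma cvg_mean_den_inv (c x : nat -> R) s : 0 < s ->
  c @ \oo --> 0 -> x @ \oo --> s ->
  (fun k => (mean_den (c k) s (x k))^-1) @ \oo --> (2 * (s * s))^-1.
Proof.
move=> s0 cc xs; have ss : 0 < 2 * (s * s) by rewrite !mulr_gt0.
apply: cvgV; first by rewrite gt_eqF.
rewrite mulr_natl mulr2n; apply: cvgD; first exact: cvg_cst.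
rewrite -[X in _ --> X]addr0; apply: cvgD; first exact: cvgM.
by rewrite -[X in _ --> X](mulr0 (0 : R)); exact: cvgM.
Qed.

Lemma cvg_mean_profile (c x : nat -> R) s : 0 < s ->
  c @ \oo --> 0 -> x @ \oo --> s ->
  (fun k => mean_profile (c k) s (x k)) @ \oo --> s.
Proof.
move=> s0 cc xs.
rewrite [X in _ --> X](_ : _ = 2 * s * (s * s) * (2 * (s * s))^-1); last first.
  by field; rewrite gt_eqF.
apply: cvgM; last exact: cvg_mean_den_inv.
by apply: cvgMr; exact: cvgM.
Qed.

(** On the diagonal the unregularized profile has gradient (0, 1). In the energy identity the
    coefficient of [G] thus tends to 0 and that of [hgrad (psi k)] to 1. *)
Lemma cvg_mean_profile_ds (c x : nat -> R) s : 0 < s ->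
  c @ \oo --> 0 -> x @ \oo --> s ->
  (fun k => mean_profile_ds (c k) s (x k)) @ \oo --> 0.
Proof.
move=> s0 cc xs; have cd := cvg_mean_den_inv s0 cc xs.
rewrite [X in _ --> X](_ : _ = 2 * (s * s) * (2 * (s * s))^-1 -
  4 * (s * s) * (s * s) * ((2 * (s * s))^-1 * (2 * (s * s))^-1)); last first.
  by field; rewrite gt_eqF.
apply: cvgB; apply: cvgM; [by apply: cvgMr; exact: cvgM|exact: cd| |exact: cvgM].
by apply: cvgMr; exact: cvgM.
Qed.

Lemma cvg_mean_profile_dt (c x : nat -> R) s : 0 < s ->
  c @ \oo --> 0 -> x @ \oo --> s ->
  (fun k => mean_profile_dt (c k) s (x k)) @ \oo --> (1 : R).
Proof.
move=> s0 cc xs; have cd := cvg_mean_den_inv s0 cc xs.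
rewrite [X in _ --> X](_ : _ = 4 * (s * s) * (2 * (s * s))^-1 -
  4 * (s * s) * (s * s) * ((2 * (s * s))^-1 * (2 * (s * s))^-1)); last first.
  by field; rewrite gt_eqF.
apply: cvgB; apply: cvgM; [by apply: cvgMr; exact: cvgMr|exact: cd| |exact: cvgM].
by apply: cvgM; [apply: cvgMr; exact: cvgMr|exact: cvgM].
Qed.

Lemma cvg_mean_den_inv_s (x : nat -> R) c s t : 0 < c -> x @ \oo --> s ->
  (fun k => (mean_den c (x k) t)^-1) @ \oo --> (mean_den c s t)^-1.
Proof.
move=> c0 xs; apply: cvgV; first by rewrite gt_eqF// mean_den_gt0.
by apply: cvgD; [exact: cvgM|exact: cvg_cst].
Qed.

Lemma cvg_mean_profile_s (x : nat -> R) c s t : 0 < c -> x @ \oo --> s ->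
  (fun k => mean_profile c (x k) t) @ \oo --> mean_profile c s t.
Proof.
move=> c0 xs; apply: cvgM; last exact: cvg_mean_den_inv_s.
by apply: cvgMl; exact: cvgMr.
Qed.

Lemma cvg_mean_profile_ds_s (x : nat -> R) c s t : 0 < c -> x @ \oo --> s ->
  (fun k => mean_profile_ds c (x k) t) @ \oo --> mean_profile_ds c s t.
Proof.
move=> c0 xs; have cd := cvg_mean_den_inv_s (t := t) c0 xs.
apply: cvgB; apply: cvgM; [exact: cvg_cst|exact: cd| |exact: cvgM].
by apply: cvgMl; apply: cvgMr; exact: cvgM.
Qed.

Lemma cvg_mean_profile_dt_s (x : nat -> R) c s t : 0 < c -> x @ \oo --> s ->
  (fun k => mean_profile_dt c (x k) t) @ \oo --> mean_profile_dt c s t.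
Proof.
move=> c0 xs; have cd := cvg_mean_den_inv_s (t := t) c0 xs.
apply: cvgB; apply: cvgM; [by apply: cvgMr; exact: cvgMl|exact: cd| |exact: cvgM].
by apply: cvgMl; apply: cvgMr; exact: cvgMl.
Qed.

End mean_profile.

(** * Testing the equation of a solution with the solution itself *)

Section energy_identity.
Context {R : realType} {n : nat}.
Local Notation H := (heisenberg R n).
Local Notation mu := (@heisenberg_measure R n).
Variables (p : R) (Omega D : set H).
Hypotheses (p1 : 1 < p) (mD : measurable D).
Local Notation energy := (energy_norm mu D p).

Lemma smooth_mean_den (c : R) (psi phi : H -> R) : smooth psi -> smooth phi ->
  smooth (fun z => mean_den c (psi z) (phi z)).
Proof.
by move=> s1 s2; exact: (smoothD (smoothM s1 s1) (smooth_sqrD (c * c) s2)).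
Qed.

Lemma mean_profileE (c s t : R) : 0 < c ->
  mean_profile c s t = 2 * s * (t * t) * mean_den c s t `^ (-1).
Proof. by move=> c0; rewrite powR_inv1// ltW// mean_den_gt0. Qed.

Lemma smooth_mean_profile (c : R) (psi phi : H -> R) : 0 < c ->
  smooth psi -> smooth phi -> smooth (fun z => mean_profile c (psi z) (phi z)).
Proof.
move=> c0 s1 s2; under eq_fun do rewrite mean_profileE//.
have sd := smooth_mean_den c s1 s2.
apply: (smoothM (smoothM (smoothM (smooth_cst 2) s1) (smoothM s2 s2))).
by apply: smooth_powR => // z; exact: mean_den_gt0.
Qed.

Lemma partial_mean_profile (c : R) (psi phi : H -> R) j z : 0 < c ->
  smooth psi -> smooth phi ->
  partial j (fun z => mean_profile c (psi z) (phi z)) z =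
  mean_profile_ds c (psi z) (phi z) * partial j psi z +
  mean_profile_dt c (psi z) (phi z) * partial j phi z.
Proof.
move=> c0 s1 s2.
have E : (fun z => mean_profile c (psi z) (phi z)) =
    (fun z => 2 * psi z * (phi z * phi z) * mean_den c (psi z) (phi z) `^ (-1)).
  by apply/funext => x; rewrite mean_profileE.
have gt x : 0 < mean_den c (psi x) (phi x) by exact: mean_den_gt0.
have sd := smooth_mean_den c s1 s2.
have s20 : smooth ((fun=> 2) : H -> R) := smooth_cst 2.
have sn1 := smoothM s20 s1; have sn2 := smoothM s2 s2.
have sn := smoothM sn1 sn2; have sp := smooth_powR (-1) gt sd.
rewrite E (partialM j z sn sp) (partial_powR _ j z gt sd).
rewrite (partialM j z sn1 sn2) (partialM j z s20 s1) (partialM j z s2 s2) partial_cst.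
rewrite (_ : partial j (fun z => mean_den c (psi z) (phi z)) z =
    2 * psi z * partial j psi z + 2 * phi z * partial j phi z); last first.
  rewrite /mean_den (partialD j z (smoothM s1 s1) (smooth_sqrD (c * c) s2)).
  by rewrite (partialM j z s1 s1) (partial_sqrD _ j z s2); ring.
have I1 : mean_den c (psi z) (phi z) `^ (-1) = (mean_den c (psi z) (phi z))^-1.
  by rewrite powR_inv1// ltW.
rewrite powRD; last by rewrite (gt_eqF (gt z)) implybT.
rewrite I1 /mean_profile_ds /mean_profile_dt; ring.
Qed.

Lemma measurable_mean_den_inv (c : R) (u phi : H -> R) :
  measurable_fun D u -> measurable_fun D phi -> 0 < c ->
  measurable_fun D (fun z => (mean_den c (u z) (phi z))^-1).
Proof.
move=> mu_ mphi c0.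
have E : (fun z => (mean_den c (u z) (phi z))^-1) =
    (fun z => mean_den c (u z) (phi z) `^ (-1)).
  by apply/funext => z; rewrite powR_inv1// ltW// mean_den_gt0.
rewrite E; apply: measurable_fun_powR; apply: measurable_funD.
  exact: measurable_funM.
by apply: measurable_funD; [exact: measurable_funM|exact: measurable_cst].
Qed.

Lemma measurable_mean_profile (c : R) (u phi : H -> R) :
  measurable_fun D u -> measurable_fun D phi -> 0 < c ->
  [/\ measurable_fun D (fun z => mean_profile c (u z) (phi z)),
    measurable_fun D (fun z => mean_profile_ds c (u z) (phi z))
  & measurable_fun D (fun z => mean_profile_dt c (u z) (phi z))].
Proof.
move=> mu_ mphi c0; have mI := measurable_mean_den_inv mu_ mphi c0.
have m2 (a : R) : measurable_fun D (fun _ : H => a) by exact: measurable_cst.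
have mpp := measurable_funM mphi mphi; have muu := measurable_funM mu_ mu_.
have mup := measurable_funM mu_ mphi; have mII := measurable_funM mI mI.
split.
- exact: (measurable_funM (measurable_funM (measurable_funM (m2 2) mu_) mpp) mI).
- apply: measurable_funB.
    exact: (measurable_funM (measurable_funM (m2 2) mpp) mI).
  exact: (measurable_funM (measurable_funM (measurable_funM (m2 4) muu) mpp) mII).
- apply: measurable_funB.
    exact: (measurable_funM (measurable_funM (m2 4) mup) mI).
  exact: (measurable_funM (measurable_funM (measurable_funM (m2 4) mup) mpp) mII).
Qed.

(** The factor phi^2 supplies both the compact support and the majorant c^-1 phi^2. Only the first
    argument of the profile passes to the limit [u]; the second remains a free test function, later
    specialized to [psi k]. *)
Lemma mean_test_function F u G psi (phi : H -> R) (c : R) :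
  solution_on p Omega D F u G psi -> test_function Omega phi ->
  (energy (hgrad phi) < +oo)%E -> 0 < c ->
  (\int[mu]_(z in D) (mean_profile_ds c (u z) (phi z) * pflux p G G z)%:E +
   \int[mu]_(z in D) (mean_profile_dt c (u z) (phi z) * pflux p G (hgrad phi) z)%:E =
   \int[mu]_(z in D) (F z * mean_profile c (u z) (phi z))%:E)%E.
Proof.
move=> sol tphi phioo c0.
have [sphi _ _] := tphi; have [M M0 phiM] := test_function_bounded tphi.
have spsi k : smooth (psi k) by have [] := sol_test sol k.
have mphi := smooth_measurable (D := D) sphi.
have mpsi k := smooth_measurable (D := D) (spsi k).
have ci0 : 0 <= c^-1 by rewrite invr_ge0 ltW.
(* 8 bounds both derivatives of the profile, and the other summand bounds the coefficient of
   [hgrad phi] in the gradient of the majorant. *)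
pose C := 8 + c^-1 * (2 * M).
have C1 : 0 <= c^-1 * (2 * M) by rewrite mulr_ge0// mulr_ge0// ltW.
have C8 : 8 <= C by rewrite lerDl.
have sw k := smooth_mean_profile c0 (spsi k) sphi.
have sB : smooth (fun z => c^-1 * (phi z * phi z)).
  exact: (smoothM (smooth_cst c^-1) (smoothM sphi sphi)).
apply: (@test_limit R n p Omega D p1 mD F u G psi phi
  (fun k z => mean_profile c (psi k z) (phi z)) _
  (fun k z => mean_profile_ds c (psi k z) (phi z))
  (fun k z => mean_profile_dt c (psi k z) (phi z)) _ _
  (fun z => c^-1 * (phi z * phi z)) (fun z => c^-1 * (2 * phi z)) C sol tphi phioo).
- by rewrite (le_trans _ C8).
- move=> k; apply: (test_function_sub tphi (sw k)) => z phi0.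
  by rewrite /mean_profile phi0 !mulr0 mul0r.
- move=> k z; apply: hgrad_lin => j.
  exact: (partial_mean_profile j z c0 (spsi k) sphi).
- by move=> k; have [] := measurable_mean_profile (mpsi k) mphi c0.
- by move=> k; have [] := measurable_mean_profile (mpsi k) mphi c0.
- move=> k z _; apply: le_trans C8.
  by apply: le_trans (normr_mean_profile_ds_le _ _ c0) _; rewrite ler_nat.
- by move=> k z _; apply: le_trans C8; exact: normr_mean_profile_dt_le.
- by move=> z Dz; apply: cvg_mean_profile_ds_s c0 _; exact: (sol_cvg sol).
- by move=> z Dz; apply: cvg_mean_profile_dt_s c0 _; exact: (sol_cvg sol).
- by move=> z Dz; apply: cvg_mean_profile_s c0 _; exact: (sol_cvg sol).
- by apply: (test_function_sub tphi sB) => z phi0; rewrite phi0 !mulr0.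
- move=> z; rewrite (@hgrad_lin _ _ phi phi _ 0 (c^-1 * (2 * phi z))).
    by rewrite scale0r add0r.
  move=> j; rewrite (partialM j z (smooth_cst c^-1) (smoothM sphi sphi)) partial_cst.
  by rewrite (partialM j z sphi sphi); ring.
- apply: measurable_funM; first exact: measurable_cst.
  by apply: measurable_funM => //; exact: measurable_cst.
- move=> z Dz; apply: (@le_trans _ _ (c^-1 * (2 * M))); last by rewrite lerDr.
  rewrite normrM (ger0_norm ci0) ler_wpM2l// normrM (ger0_norm (ler0n R 2)).
  by rewrite ler_wpM2l.
- by move=> k z _; exact: normr_mean_profile_le.
Qed.

(** Picone's inequality with both solutions equal, as u^p u^(1-p) = u. It yields the integrability
    of F u, on which the energy identity relies for domination. *)
Lemma work_le_energy F u G psi : solution_on p Omega D F u G psi ->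
  (\int[mu]_(z in D) (F z * u z)%:E <= \int[mu]_(z in D) (enorm (G z) `^ p)%:E)%E.
Proof.
move=> sol; apply: le_trans (picone_integral p1 mD sol sol).
rewrite le_eqVlt; apply/orP; left; apply/eqP; apply: eq_integral => z /set_mem Dz.
have u0 := sol_u_gt0 sol Dz.
rewrite -powRD; last by rewrite (gt_eqF u0) implybT.
by rewrite [p + _]addrC subrK powRr1// ltW.
Qed.

Lemma work_integrable F u G psi : solution_on p Omega D F u G psi ->
  mu.-integrable D (EFin \o (fun z => F z * u z)).
Proof.
move=> sol; apply/integrableP; split.
  by apply/measurable_EFinP; exact: measurable_funM (sol_mF sol) (sol_mu sol).
under eq_integral => z /set_mem Dz.
  rewrite gee0_abs; last first.
    by rewrite lee_fin mulr_ge0 ?(ltW (sol_F_gt0 sol Dz)) ?(ltW (sol_u_gt0 sol Dz)).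
  over.
apply: le_lt_trans (work_le_energy sol) _.
have := energy_integral_lty p1 (sol_Goo sol).
by rewrite fin_numElt => /andP[].
Qed.

(* The equation tested with [u], as the limit of [mean_profile c u phi]. *)
Lemma energy_identity F u G psi : solution_on p Omega D F u G psi ->
  (\int[mu]_(z in D) (F z * u z)%:E = \int[mu]_(z in D) (enorm (G z) `^ p)%:E)%E.
Proof.
move=> sol; pose c k : R := k.+1%:R^-1.
have c0 k : 0 < c k by exact: inv_natS_gt0.
have cc : c @ \oo --> 0 by exact: cvg_inv_natS.
have mG := sol_mG sol; have Goo := sol_Goo sol.
have mu_ := sol_mu sol; have mF := sol_mF sol.
have mpsi k : measurable_fun D (psi k).
  by apply: smooth_measurable; have [] := sol_test sol k.
have mm k := measurable_mean_profile mu_ (mpsi k) (c0 k).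
have E k := mean_test_function sol (sol_test sol k) (sol_psioo sol k) (c0 k).
have EF : (\int[mu]_(z in D) (F z * mean_profile (c k) (u z) (psi k z))%:E @[k --> \oo]
    --> \int[mu]_(z in D) (F z * u z)%:E)%E.
  (* The majorant 2 F u does not depend on k. *)
  have i2 : mu.-integrable D (fun z => (2 * (F z * u z))%:E).
    by have := integrableZl mD 2 (work_integrable sol).
  have [] // := @dominated_convergence _ _ _ mu _ mD
    (fun k z => (F z * mean_profile (c k) (u z) (psi k z))%:E)
    (fun z => (F z * u z)%:E) _ _ _ _ i2.
  - move=> k; apply/measurable_EFinP; apply: (measurable_funM mF).
    by have [] := mm k.
  - by apply/measurable_EFinP; exact: (measurable_funM mF mu_).
  - apply: aeW => z Dz; apply: cvg_EFin; first exact: nearW.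
    apply: cvgMr; apply: cvg_mean_profile => //; first exact: (sol_u_gt0 sol).
    exact: (sol_cvg sol).
  - apply: aeW => z k Dz; rewrite lee_fin.
    have u0 := sol_u_gt0 sol Dz; have F0 := sol_F_gt0 sol Dz.
    have /andP[m0 m1] := mean_profile_bounds (psi k z) (c0 k) (ltW u0).
    rewrite (ger0_norm (mulr_ge0 (ltW F0) m0)) [leRHS]mulrCA.
    by rewrite ler_wpM2l// ltW.
have ca := @pflux_cvg _ _ _ mu D mD _ p p1 G mG Goo
  (fun k z => mean_profile_ds (c k) (u z) (psi k z)) (fun=> 0) (fun=> G) G 6.
have cb := @pflux_cvg _ _ _ mu D mD _ p p1 G mG Goo
  (fun k z => mean_profile_dt (c k) (u z) (psi k z)) (fun=> 1)
  (fun k => hgrad (psi k)) G 8.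
have {}ca : (\int[mu]_(z in D) (mean_profile_ds (c k) (u z) (psi k z) * pflux p G G z)%:E
    @[k --> \oo] --> \int[mu]_(z in D) (0 * pflux p G G z)%:E)%E.
  apply: ca => //.
  - by move=> k; have [] := mm k.
  - by move=> k z _; exact: normr_mean_profile_ds_le.
  - move=> z Dz; apply: cvg_mean_profile_ds => //; first exact: (sol_u_gt0 sol).
    exact: (sol_cvg sol).
  - under eq_fun do under [X in energy X]eq_fun do rewrite subrr.
    by rewrite energy_norm_cst0//; exact: cvg_cst.
have {}cb : (\int[mu]_(z in D) (mean_profile_dt (c k) (u z) (psi k z) *
    pflux p G (hgrad (psi k)) z)%:E
    @[k --> \oo] --> \int[mu]_(z in D) (1 * pflux p G G z)%:E)%E.
  apply: cb => //.
  - by move=> k; have [] := mm k.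
  - by move=> k; exact: (sol_mpsi k sol).
  - by move=> k z _; exact: normr_mean_profile_dt_le.
  - move=> z Dz; apply: cvg_mean_profile_dt => //; first exact: (sol_u_gt0 sol).
    exact: (sol_cvg sol).
  - exact: (sol_psioo sol).
  - exact: (sol_cvgG sol).
have I0 : (\int[mu]_(z in D) (0 * pflux p G G z)%:E = 0)%E.
  by apply: integral0_eq => z _; rewrite mul0r.
have I1 : (\int[mu]_(z in D) (1 * pflux p G G z)%:E =
    \int[mu]_(z in D) (enorm (G z) `^ p)%:E)%E.
  by apply: eq_integral => z _; rewrite mul1r pflux_self.
rewrite I0 in ca; rewrite I1 in cb.
have fd : (0 +? \int[mu]_(z in D) (enorm (G z) `^ p)%:E)%E by rewrite fin_num_adde_defr.
have cab : (\int[mu]_(z in D) (F z * mean_profile (c k) (u z) (psi k z))%:E @[k --> \oo]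
    --> \int[mu]_(z in D) (enorm (G z) `^ p)%:E)%E.
  by rewrite -(eq_cvg _ _ E); have := cvgeD fd ca cb; rewrite add0e; apply.
by rewrite -(cvg_lim _ EF)// (cvg_lim _ cab).
Qed.

End energy_identity.

(** * Uniqueness *)

Section uniqueness.
Context {R : realType} {n : nat}.
Local Notation H := (heisenberg R n).
Local Notation mu := (@heisenberg_measure R n).
Variables (p : R) (Omega D : set H).
Hypotheses (p1 : 1 < p) (mD : measurable D).

Let p0 : 0 < p. Proof. exact: lt_trans p1. Qed.

(** Integrability, and not only an upper bound on the integral, is what allows these terms to be
    combined with F u and F' v in a single integral. *)
Lemma cross_work_integrable F u G psi F' v G' phi :
  solution_on p Omega D F u G psi -> solution_on p Omega D F' v G' phi ->
  mu.-integrable D (EFin \o (fun z => F z * (v z `^ p * u z `^ (1 - p)))).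
Proof.
move=> solu solv; apply/integrableP; split.
  apply/measurable_EFinP; apply: measurable_funM (sol_mF solu) _.
  apply: measurable_funM; apply: measurable_fun_powR.
    exact: sol_mu solv.
  exact: sol_mu solu.
under eq_integral => z /set_mem Dz.
  rewrite gee0_abs; last first.
    by rewrite lee_fin !mulr_ge0 ?powR_ge0// ltW// (sol_F_gt0 solu).
  over.
apply: le_lt_trans (picone_integral p1 mD solu solv) _.
have := energy_integral_lty p1 (sol_Goo solv).
by rewrite fin_numElt => /andP[].
Qed.

(** Writing s as s^p / s^(p-1) in F u and F' v exposes a product of two differences, which have the
    same sign by the monotonicity assumption. *)
Lemma work_differenceE (F F' u v : R) : 0 < u -> 0 < v ->
  (F * (v `^ p * u `^ (1 - p)) + F' * (u `^ p * v `^ (1 - p))) - (F * u + F' * v) =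
  (v `^ p - u `^ p) * (F / u `^ (p - 1) - F' / v `^ (p - 1)).
Proof.
move=> u0 v0; have E (s : R) : 0 < s -> s = s `^ p * (s `^ (p - 1))^-1.
  move=> s0; rewrite -powRN -powRD; last by rewrite (gt_eqF s0) implybT.
  by rewrite opprB addrCA subrr addr0 powRr1// ltW.
rewrite [in X in _ - X](E u u0) [in X in _ - X](E v v0).
rewrite -(opprB p 1) !powRN; ring.
Qed.

Lemma ae_eq_solutions F u G psi F' v G' phi :
  solution_on p Omega D F u G psi -> solution_on p Omega D F' v G' phi ->
  (forall z, D z -> u z < v z -> F' z / v z `^ (p - 1) < F z / u z `^ (p - 1)) ->
  (forall z, D z -> v z < u z -> F z / u z `^ (p - 1) < F' z / v z `^ (p - 1)) ->
  {ae mu, forall z, D z -> u z = v z}.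
Proof.
move=> solu solv uv vu.
have i1 := cross_work_integrable solu solv.
have i2 := cross_work_integrable solv solu.
have i3 := work_integrable p1 mD solu.
have i4 := work_integrable p1 mD solv.
have i12 := integrableD mD i1 i2; have i34 := integrableD mD i3 i4.
pose g z := (F z * (v z `^ p * u z `^ (1 - p)) + F' z * (u z `^ p * v z `^ (1 - p)))
  - (F z * u z + F' z * v z).
have mono (s t : R) : 0 < s -> s < t -> s `^ p < t `^ p.
  move=> s0 st; apply: gt0_ltr_powR; rewrite ?nnegrE// ltW//.
  exact: lt_trans st.
have g_ge0 z : D z -> 0 <= g z /\ (g z = 0 -> u z = v z).
  move=> Dz; have u0 := sol_u_gt0 solu Dz; have v0 := sol_u_gt0 solv Dz.
  rewrite /g (work_differenceE _ _ u0 v0); have [lt|lt|->] := ltgtP (u z) (v z).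
  - have h : 0 < (v z `^ p - u z `^ p) *
        (F z / u z `^ (p - 1) - F' z / v z `^ (p - 1)).
      by apply: mulr_gt0; rewrite subr_gt0; [exact: mono|exact: uv].
    by split=> [|h0]; [exact: ltW|move: h; rewrite h0 ltxx].
  - have h : 0 < (v z `^ p - u z `^ p) *
        (F z / u z `^ (p - 1) - F' z / v z `^ (p - 1)).
      by rewrite -mulrNN; apply: mulr_gt0; rewrite oppr_gt0 subr_lt0;
        [exact: mono|exact: vu].
    by split=> [|h0]; [exact: ltW|move: h; rewrite h0 ltxx].
  - by rewrite subrr mul0r.
have gE : (EFin \o g) = (fun z =>
    ((EFin \o (fun z => F z * (v z `^ p * u z `^ (1 - p)))%R) \+
     (EFin \o (fun z => F' z * (u z `^ p * v z `^ (1 - p)))%R)) z -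
    ((EFin \o (fun z => F z * u z)%R) \+ (EFin \o (fun z => F' z * v z)%R)) z)%E.
  by apply/funext => z; rewrite /g /= -!EFinD.
have ig : mu.-integrable D (EFin \o g) by rewrite gE; exact: integrableB.
have Ig : (\int[mu]_(z in D) (EFin \o g) z <= 0)%E.
  rewrite gE integralB// integralD// integralD//.
  rewrite leeBlDr; last by rewrite -integralD//; exact: integrable_fin_num.
  (* The terms pair crosswise: Picone's inequality bounds the one with v^p / u^(p-1) by the energy
     of [v], which equals the integral of F' v. *)
  rewrite add0e [leRHS]addeC; apply: leeD.
    by rewrite (energy_identity p1 mD solv); exact: (picone_integral p1 mD solu solv).
  by rewrite (energy_identity p1 mD solu); exact: (picone_integral p1 mD solv solu).
have mg : measurable_fun D (EFin \o g) by have /integrableP[] := ig.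
have : (\int[mu]_(z in D) `|(EFin \o g) z| = 0)%E.
  apply/eqP; rewrite eq_le; apply/andP; split; last by apply: integral_ge0.
  rewrite (eq_integral (EFin \o g))// => z /set_mem Dz.
  by rewrite gee0_abs// lee_fin; have [] := g_ge0 z Dz.
move=> /(ae_eq_integral_abs mu mD mg); apply: filterS => z /= h Dz.
by have [_] := g_ge0 z Dz; apply; have [] := h Dz.
Qed.

End uniqueness.

(** * From weak solutions to pointwise properties off a null set *)

Section weak_solutions.
Context {R : realType} {n : nat}.
Local Notation H := (heisenberg R n).
Local Notation mu := (@heisenberg_measure R n).
Implicit Types (Omega N : set H).

Lemma Lp_norm_setD_null (p : R) Omega N (g : H -> R) : p != 0 ->
  measurable N -> mu N = 0%E ->
  Lp_norm p%:E (Omega `\` N) g = Lp_norm p%:E Omega g.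
Proof.
by move=> p0 mN N0; rewrite !Lp_normE// [in RHS](integral_setD_null _ _ mN N0).
Qed.

Lemma enorm_le_sum m (w : 'rV[R]_m) : enorm w <= \sum_i `|w ord0 i|.
Proof.
rewrite -ler_sqr ?nnegrE ?enorm_ge0 ?sumr_ge0// enorm_sqr /dotv.
elim: (index_enum 'I_m) => [|i s IH]; first by rewrite !big_nil expr0n.
rewrite !big_cons sqrrD -expr2 real_normK ?num_real// -addrA lerD2l.
apply: le_trans IH _; rewrite lerDr mulrn_wge0// mulr_ge0// sumr_ge0//.
Qed.

(** The Euclidean norm is at most the sum of the absolute values of the components, to which
    Minkowski's inequality applies by induction. *)
Lemma energy_lty_of_components (p : R) (D : set H) m (G : H -> 'rV[R]_m) : 1 < p ->
  measurable D -> vmeasurable D G ->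
  (forall i, (Lp_norm p%:E D (fun z => G z ord0 i) < +oo)%E) ->
  (energy_norm mu D p G < +oo)%E.
Proof.
move=> p1 mD mG Goo; have p0 : 0 < p by exact: lt_trans p1.
have mG' i : measurable_fun D (fun z => `|G z ord0 i|).
  by apply: measurableT_comp => //; exact: mG.
have mS s : measurable_fun D (fun z => \sum_(i <- s) `|G z ord0 i|).
  exact: measurable_sum.
have Soo s :
    ('N[mu]_p%:E[(EFin \o (fun z => (\sum_(i <- s) `|G z ord0 i|)%R)) \_ D] < +oo)%E.
  elim: s => [|i s IH].
    rewrite (_ : _ \_ _ = cst 0%E) ?Lnorm0// ?eqe ?gt_eqF//.
    by apply/funext => z; rewrite patchE /= big_nil; case: ifP.
  under [X in (EFin \o X)]eq_fun do rewrite big_cons.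
  apply: le_lt_trans (minkowski_set mu mD (mG' i) (mS s) (ltW p1)) _.
  rewrite lte_add_pinfty//; apply: le_lt_trans (Goo i).
  apply: le_Lnorm_set => // z _; by rewrite normr_id.
apply: le_lt_trans (Soo (index_enum 'I_m)).
apply: le_Lnorm_set => //; first exact: measurable_enorm.
move=> z _; rewrite !ger0_norm ?enorm_ge0 ?sumr_ge0//; exact: enorm_le_sum.
Qed.

(** Off [N] the function [u] is a pointwise limit of smooth functions, hence Borel, and so is f(.,
    u) by superposition; removing [N] changes neither the norms nor the integrals. *)
Lemma solution_on_setD_null (p : R) Omega N (f : H -> R -> R) (u : H -> R)
    (G : H -> 'rV[R]_(n + n)) (psi : nat -> H -> R) :
  1 < p -> measurable Omega -> measurable N -> mu N = 0%E ->
  (forall z, (Omega `\` N) z -> 0 < u z) ->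
  (forall z r, Omega z -> 0 <= r -> 0 < f z r) ->
  (forall z, (Omega `\` N) z -> {within `[0, +oo[, continuous (f z)}) ->
  (forall j m : nat, measurable_fun (Omega `\` N) (f ^~ (j%:R / m.+1%:R))) ->
  vmeasurable (Omega `\` N) G ->
  (forall i, (Lp_norm p%:E Omega (fun z => G z ord0 i) < +oo)%E) ->
  (forall k, test_function Omega (psi k)) ->
  (fun k => Lp_norm p%:E Omega (fun z => enorm (hgrad (psi k) z - G z)))
    @ \oo --> 0%E ->
  (forall z, (Omega `\` N) z -> psi ^~ z @ \oo --> u z) ->
  (forall phi, test_function Omega phi ->
    (\int[mu]_(z in Omega)
       (enorm (G z) `^ (p - 2) * dotv (G z) (hgrad phi z))%:E =
     \int[mu]_(z in Omega) (f z (u z) * phi z)%:E)%E) ->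
  exists psi', solution_on p Omega (Omega `\` N) (fun z => f z (u z)) u G psi'.
Proof.
move=> p1 mO mN N0 u0 f0 cf mf mG Goo tpsi cG cu eqn.
set D := Omega `\` N; have mD : measurable D by exact: measurableD.
have pN0 : p != 0 by rewrite gt_eqF// (lt_trans _ p1).
have mpsi k : measurable_fun D (psi k).
  by apply: smooth_measurable; have [] := tpsi k.
have mgpsi k : vmeasurable D (hgrad (psi k)).
  by apply: vmeasurable_hgrad; have [] := tpsi k.
have mu_ : measurable_fun D u by exact: measurable_fun_cvg mpsi cu.
have cG' : energy_norm mu D p (fun z => hgrad (psi k) z - G z) @[k --> \oo] --> 0%E.
  apply: cvg_trans cG; apply: near_eq_cvg; apply: nearW => k.
  by rewrite -(Lp_norm_setD_null _ _ pN0 mN N0).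
have GDoo : (energy_norm mu D p G < +oo)%E.
  by apply: energy_lty_of_components => // i; rewrite (Lp_norm_setD_null _ _ pN0 mN N0).
(* Convergence to 0 in the extended reals gives finite norms only from some index [k0] on, so the
   sequence is shifted by [k0]. *)
have /fine_cvgP[[k0 _ k0P] _] := cG'.
exists (fun k => psi (k + k0)%N); apply: SolutionOn.
- exact: mu_.
- exact: u0.
- have u0' z : D z -> 0 <= u z by move=> Dz; exact/ltW/u0.
  exact: (measurable_superposition mD mu_ u0' cf mf).
- by move=> z Dz; apply: f0; [exact: Dz.1|exact/ltW/u0].
- exact: mG.
- exact: GDoo.
- by move=> k; exact: tpsi.
- move=> k; have := k0P (k + k0)%N (leq_addl _ _); rewrite fin_numElt => /andP[_ koo].
  have := energy_normD mu mD p1 (vmeasurableB (mgpsi (k + k0)%N) mG) mG.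
  rewrite (_ : (fun z => _) = hgrad (psi (k + k0)%N)); last first.
    by apply/funext => z; rewrite subrK.
  by move=> /le_lt_trans; apply; exact: lte_add_pinfty.
- exact: (cvg_comp (addn^~ k0)
    (fun k => energy_norm mu D p (fun z => hgrad (psi k) z - G z)) (cvg_addnr k0) cG').
- move=> z Dz; exact: (cvg_comp (addn^~ k0) (psi ^~ z) (cvg_addnr k0) (cu z Dz)).
- by move=> phi tphi; rewrite -!(integral_setD_null _ _ mN N0); exact: eqn.
Qed.

End weak_solutions.

Theorem theorem3p1 (R : realType) (n : nat) (p : R)
    (Omega : set (heisenberg R n)) (f : heisenberg R n -> R -> R)
    (n_gt0 : (0 < n)%N) (p_gt1 : 1 < p)
    (Omega_open : open Omega) (Omega_connected : connected Omega)
    (Omega_nonempty : Omega !=set0) (Omega_bounded : bounded_set Omega)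
    (f_gt0 : forall z r, Omega z -> 0 <= r -> 0 < f z r)
    (f_cont : {ae heisenberg_measure, forall z, Omega z ->
       {within `[0, +oo[, continuous (f z)}})
    (f_Linfty : forall r, 0 <= r -> Lp +oo%E Omega (fun z => f z r))
    (f_decr : {ae heisenberg_measure, forall z, Omega z ->
       forall r s, 0 < r -> r < s ->
         f z s / s `^ (p - 1) < f z r / r `^ (p - 1)})
    (f_growth : exists2 C : R, 0 < C &
       {ae heisenberg_measure, forall z, Omega z ->
         forall r, 0 <= r -> f z r <= C * (r `^ (p - 1) + 1)}) :
  forall u v : heisenberg R n -> R,
    positive_weak_solution p Omega f u ->
    positive_weak_solution p Omega f v ->
    {ae heisenberg_measure, forall z, Omega z -> u z = v z}.
Proof.
move=> u v [[_ [G [LG [psi [tpsi cpsi apsi]]] equ]] _ _ u0].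
move=> [[_ [G' [LG' [phi [tphi cphi aphi]]] eqv]] _ _ v0].
set mu := heisenberg_measure in f_cont f_decr apsi equ u0 aphi eqv v0 *.
have mO : measurable Omega by exact: open_measurable_rV.
(* Each component of a gradient has a Borel representative; their finitely many exceptional sets are
   merged into one. *)
have borel (g : 'I_(n + n) -> heisenberg R n -> R) :
    (forall i, Lp p%:E Omega (g i)) ->
    exists h : 'I_(n + n) -> heisenberg R n -> R,
      (forall i, measurable_fun Omega (h i)) /\
      {ae mu, forall z, forall i, Omega z -> g i z = h i z}.
  move=> Lg; have /choice[h hP] : forall i, exists h : heisenberg R n -> R,
      measurable_fun Omega h /\ {ae mu, forall z, Omega z -> g i z = h z}.
    by move=> i; have [[h mh gh] _] := Lg i; exists h.
  exists h; split=> [i|]; first by have [] := hP i.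
  by apply: filter_forall => i; have [] := hP i.
have [h [mh Gh]] := borel _ LG; have [h' [mh' Gh']] := borel _ LG'.
(* [measurable_superposition] evaluates [f] at countably many rational arguments only, so the
   exceptional null sets of f(., r) can be united. *)
have /choice[k kP] : forall jm : nat * nat, exists k : heisenberg R n -> R,
    measurable_fun Omega k /\
    {ae mu, forall z, Omega z -> f z (jm.1%:R / jm.2.+1%:R) = k z}.
  move=> jm; have r0 : 0 <= jm.1%:R / jm.2.+1%:R :> R by rewrite divr_ge0.
  by have [[k mk fk] _] := f_Linfty _ r0; exists k.
have fk : {ae mu, forall z, forall j m, Omega z -> f z (j%:R / m.+1%:R) = k (j, m) z}.
  by apply: ae_foralln => j; apply: ae_foralln => m; have [_] := kP (j, m).
(* A single Borel null set [N] serves all the almost everywhere properties and both solutions, since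
   the two have to be compared on the same set. *)
have := filterI f_cont (filterI f_decr (filterI apsi (filterI aphi (filterI u0
  (filterI v0 (filterI Gh (filterI Gh' fk))))))).
move=> [N [mN N0 subN]].
have good z : (Omega `\` N) z -> _ := fun Dz => contrapT (fun nA => Dz.2 (subN z nA)).
have mD : measurable (Omega `\` N) by exact: measurableD.
have DO : Omega `\` N `<=` Omega by move=> z [].
have mG : vmeasurable (Omega `\` N) G.
  move=> i; apply: eq_measurable_fun (measurable_funS mO DO (mh i)) => z /set_mem Dz.
  by have [_ [_ [_ [_ [_ [_ [E _]]]]]]] := good z Dz; rewrite E//; exact: DO.
have mG' : vmeasurable (Omega `\` N) G'.
  move=> i; apply: eq_measurable_fun (measurable_funS mO DO (mh' i)) => z /set_mem Dz.
  by have [_ [_ [_ [_ [_ [_ [_ [E _]]]]]]]] := good z Dz; rewrite E//; exact: DO.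
have mf j m : measurable_fun (Omega `\` N) (f ^~ (j%:R / m.+1%:R)).
  have mk : measurable_fun Omega (k (j, m)) by have [] := kP (j, m).
  apply: eq_measurable_fun (measurable_funS mO DO mk) => z /set_mem Dz.
  by have [_ [_ [_ [_ [_ [_ [_ [_ E]]]]]]]] := good z Dz; rewrite E//; exact: DO.
have cf z : (Omega `\` N) z -> {within `[0, +oo[, continuous (f z)}.
  by move=> Dz; have [E _] := good z Dz; exact: E (DO _ Dz).
have [psi' solu] : exists psi', solution_on p Omega (Omega `\` N)
    (fun z => f z (u z)) u G psi'.
  apply: (solution_on_setD_null p_gt1 mO mN N0 _ f_gt0 cf mf mG _ tpsi cpsi _ equ).
  - by move=> z Dz; have [_ [_ [_ [_ [E _]]]]] := good z Dz; exact: E (DO _ Dz).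
  - by move=> i; have [] := LG i.
  - by move=> z Dz; have [_ [_ [E _]]] := good z Dz; exact: E (DO _ Dz).
have [phi' solv] : exists phi', solution_on p Omega (Omega `\` N)
    (fun z => f z (v z)) v G' phi'.
  apply: (solution_on_setD_null p_gt1 mO mN N0 _ f_gt0 cf mf mG' _ tphi cphi _ eqv).
  - by move=> z Dz; have [_ [_ [_ [_ [_ [E _]]]]]] := good z Dz; exact: E (DO _ Dz).
  - by move=> i; have [] := LG' i.
  - by move=> z Dz; have [_ [_ [_ [E _]]]] := good z Dz; exact: E (DO _ Dz).
have uv := ae_eq_solutions p_gt1 mD solu solv.
have nN : {ae mu, forall z, ~ N z}.
  by exists N; split=> // z /= /contrapT.
apply: filterS2 nN (uv _ _) => [z Nz h_ Oz|z Dz|z Dz]; first exact: h_.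
- have [_ [E _]] := good z Dz; apply: E; first exact: DO.
  exact: (sol_u_gt0 solu).
- have [_ [E _]] := good z Dz; apply: E; first exact: DO.
  exact: (sol_u_gt0 solv).
Qed.
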